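(* Let $K$ be a field of characteristic zero, let $X$ be a smooth irreducible affine algebraic variety of dimension $n\ge 1$ over $K$, and let $\mathcal{D}(X)$ be the ring of differential operators on $X$. If a $K$-algebra $A$ is Morita equivalent to $\mathcal{D}(X)$, then $$\operatorname{GK}(M)\ \ge\ n=\frac{\operatorname{GK}(A)}{2}$$ for all nonzero finitely generated $A$-modules $M$.
   Context: Algebras are associative unital $K$-algebras; modules are left modules. $\operatorname{GK}$ denotes Gelfand-Kirillov dimension: if $A$ is generated by $a_1,\dots,a_s$, put $A_0:=K$, $A_1:=K+\sum_j Ka_j$, $A_i:=A_1^i$, and for $M=AM_0$ with $M_0$ a finite dimensional generating subspace put $M_i:=A_iM_0$; then $\operatorname{GK}(A)=\gamma(i\mapsto\dim_K A_i)$ and $\operatorname{GK}(M)=\gamma(i\mapsto\dim_K M_i)$, where $\gamma(f)=\inf\{r\in\mathbb{R}\mid f(i)\le i^r\text{ for } i\gg 0\}$. An algebra Morita equivalent to a finitely generated algebra is finitely generated, and $\mathcal{D}(X)$ is finitely generated. Morita equivalence of $K$-algebras $A$ and $B$ means that there is a Morita context $\begin{pmatrix} A & P\\ Q & B\end{pmatrix}$ of $K$-algebras with bimodules ${}_AP_B$, ${}_BQ_A$ such that $PQ=A$ and $QP=B$. *)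

(* Defs.v *)
From HB Require Import structures.
From mathcomp Require Import all_boot all_order all_algebra.
From mathcomp Require Import sesquilinear.
From mathcomp Require Import all_classical all_reals all_analysis.
(* The notations of mpoly clash with those of mathcomp-analysis. *)
From mathcomp Require Import (canonicals) mpoly.

Set Implicit Arguments.
Unset Strict Implicit.
Unset Printing Implicit Defensive.

Import Order.TTheory GRing.Theory Num.Theory.

Local Open Scope classical_set_scope.
Local Open Scope ring_scope.

Definition lin_span (F : pzRingType) (V : lmodType F) (S : set V) : set V :=
  [set v | exists (k : nat) (c : 'I_k -> F) (w : 'I_k -> V),
     (forall i, S (w i)) /\ v = \sum_(i < k) c i *: w i].

Definition lin_indep (F : fieldType) (V : lmodType F) (d : nat)
    (v : 'I_d -> V) : Prop :=
  forall c : 'I_d -> F, \sum_(i < d) c i *: v i = 0 -> forall i, c i = 0.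

Definition has_lin_dim (F : fieldType) (V : lmodType F) (U : set V) (d : nat)
    : Prop :=
  exists v : 'I_d -> V, lin_indep v /\ U = lin_span (range v).

(* The value is only meaningful for finite dimensional subspaces. *)
Definition lin_dim (F : fieldType) (V : lmodType F) (U : set V) : nat :=
  xget 0%N [set d | has_lin_dim U d].

(* gamma f = inf { r in R | f i <= i ^ r for i >> 0 } *)
Definition growth (R : realType) (f : nat -> nat) : \bar R :=
  ereal_inf [set r%:E | r in
    [set r : R | \forall i \near \oo, (f i)%:R <= i%:R `^ r]].

(* A_i = (K + K a_1 + ... + K a_s) ^ i *)
Fixpoint alg_filtration (K : fieldType) (A : algType K) (a : seq A) (i : nat)
    : set A :=
  if i is j.+1 then
    lin_span [set z | exists x y, [/\ lin_span (1 |` [set` a]) x,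
                                  alg_filtration a j y & z = x * y]]
  else lin_span [set 1].

Definition alg_generates (K : fieldType) (A : algType K) (a : seq A) : Prop :=
  \bigcup_i alg_filtration a i = setT.

(* The growth rate does not depend on the generators, so GK_alg R A is its
   value for any of them; it is -oo when A is not finitely generated. *)
Definition GK_alg (R : realType) (K : fieldType) (A : algType K) : \bar R :=
  xget -oo%E [set growth R (fun i => lin_dim (alg_filtration a i))
             | a in @alg_generates K A].

(* M with scalars restricted along K -> A. *)
Definition restr (K : fieldType) (A : algType K) (M : lmodType A) : Type := M.

Section RestrictionOfScalars.
Variables (K : fieldType) (A : algType K) (M : lmodType A).

HB.instance Definition _ := GRing.Zmodule.on (restr M).

Let rscale (c : K) (m : restr M) : restr M := (c%:A : A) *: (m : M).

Fact rscaleA c d m : rscale c (rscale d m) = rscale (c * d) m.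
Proof. by rewrite /rscale [LHS]scalerA -scalerAl mul1r scalerA. Qed.

Fact rscale1 : left_id 1 rscale.
Proof. by move=> m; rewrite /rscale scale1r; exact: scale1r. Qed.

Fact rscaleDr : right_distributive rscale +%R.
Proof. by move=> c m m'; exact: scalerDr. Qed.

Fact rscaleDl m : {morph rscale^~ m : c d / c + d}.
Proof. by move=> c d; rewrite /rscale scalerDl; exact: scalerDl. Qed.

HB.instance Definition _ := GRing.Zmodule_isLmodule.Build K (restr M)
  rscaleA rscale1 rscaleDr rscaleDl.

End RestrictionOfScalars.

(* M_i = A_i M_0 *)
Definition mod_filtration (K : fieldType) (A : algType K) (M : lmodType A)
    (a : seq A) (M0 : set (restr M)) (i : nat) : set (restr M) :=
  lin_span [set z : restr M | exists (x : A) (m : restr M),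
     [/\ alg_filtration a i x, M0 m & z = x *: (m : M)]].

(* M0 is a finite dimensional K-subspace with A M0 = M *)
Definition mod_generates (K : fieldType) (A : algType K) (M : lmodType A)
    (M0 : set (restr M)) : Prop :=
  (exists d, has_lin_dim M0 d) /\ lin_span (M0 : set M) = setT.

Definition fg_module (S : pzRingType) (M : lmodType S) : Prop :=
  exists x : seq M, lin_span [set` x] = setT.

(* As for algebras, independent of the choice of the generators of A and of
   M0, with value -oo if there are none. *)
Definition GK_mod (R : realType) (K : fieldType) (A : algType K)
    (M : lmodType A) : \bar R :=
  xget -oo%E [set growth R (fun i => lin_dim (@mod_filtration K A M g.1 g.2 i))
             | g in [set g | alg_generates g.1 /\ mod_generates g.2]].

(* The products between the entries of a matrix algebra
     ( A P )
     ( Q B );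
   PQ and QP are the products P x Q -> A and Q x P -> B. *)
Record morita_context (K : fieldType) (A B : algType K) := MoritaContext {
  mcP : lmodType K;
  mcQ : lmodType K;
  mAP : {bilinear A -> mcP -> mcP};
  mPB : {bilinear mcP -> B -> mcP};
  mBQ : {bilinear B -> mcQ -> mcQ};
  mQA : {bilinear mcQ -> A -> mcQ};
  mPQ : {bilinear mcP -> mcQ -> A};
  mQP : {bilinear mcQ -> mcP -> B};
  mAP1 : forall p, mAP 1 p = p;
  mPB1 : forall p, mPB p 1 = p;
  mBQ1 : forall q, mBQ 1 q = q;
  mQA1 : forall q, mQA q 1 = q;
  mAAP : forall a a' p, mAP (a * a') p = mAP a (mAP a' p);
  mAPB : forall a p b, mPB (mAP a p) b = mAP a (mPB p b);
  mPBB : forall p b b', mPB p (b * b') = mPB (mPB p b) b';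
  mBBQ : forall b b' q, mBQ (b * b') q = mBQ b (mBQ b' q);
  mBQA : forall b q a, mQA (mBQ b q) a = mBQ b (mQA q a);
  mQAA : forall q a a', mQA q (a * a') = mQA (mQA q a) a';
  mAPQ : forall a p q, mPQ (mAP a p) q = a * mPQ p q;
  mPBQ : forall p b q, mPQ (mPB p b) q = mPQ p (mBQ b q);
  mPQA : forall p q a, mPQ p (mQA q a) = mPQ p q * a;
  mBQP : forall b q p, mQP (mBQ b q) p = b * mQP q p;
  mQAP : forall q a p, mQP (mQA q a) p = mQP q (mAP a p);
  mQPB : forall q p b, mQP q (mPB p b) = mQP q p * b;
  mPQP : forall p q p', mAP (mPQ p q) p' = mPB p (mQP q p');
  mQPQ : forall q p q', mBQ (mQP q p) q' = mQA q (mPQ p q')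
}.

Definition morita_equivalent (K : fieldType) (A B : algType K) : Prop :=
  exists C : morita_context A B,
    lin_span [set mPQ C x.1 x.2 | x in [set: mcP C * mcQ C]] = setT /\
    lin_span [set mQP C x.1 x.2 | x in [set: mcQ C * mcP C]] = setT.

(* u has order at most i: its commutators with multiplication operators have
   order at most i - 1, and are zero if i = 0. *)
Fixpoint diff_order (K : fieldType) (O : comAlgType K) (i : nat) (u : O -> O)
    : Prop :=
  if i is j.+1 then
    forall a : O, diff_order j (fun x => u (a * x) - a * u x)
  else forall a x : O, u (a * x) - a * u x = 0.

Definition is_diffop (K : fieldType) (O : comAlgType K) (u : O -> O) : Prop :=
  (forall (c : K) (x y : O), u (c *: x + y) = c *: u x + u y) /\
  exists i, diff_order i u.

Section DiffopTheory.
Variables (K : fieldType) (O : comAlgType K).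
Implicit Types u v : O -> O.

Lemma diff_orderS i u : diff_order i u -> diff_order i.+1 u.
Proof.
elim: i u => [|i IH] u hu a; last exact: IH (hu a).
by move=> b x; rewrite !hu mulr0 subr0.
Qed.

Lemma diff_order_le i j u : (i <= j)%N -> diff_order i u -> diff_order j u.
Proof.
move=> /subnK <-; elim: (j - i)%N => [//|k IH] hu.
by rewrite addSn; apply/diff_orderS/IH.
Qed.

Lemma diff_orderP i c u v : diff_order i u -> diff_order i v ->
  diff_order i (fun x => c *: u x + v x).
Proof.
elim: i u v => [|i IH] u v hu hv a => [x|].
  rewrite mulrDr -scalerAr opprD addrACA -scalerBr.
  by rewrite (hu a x) (hv a x) scaler0 addr0.
have := IH _ _ (hu a) (hv a); congr diff_order; apply/funext => x.
by rewrite mulrDr -scalerAr opprD addrACA -scalerBr.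
Qed.

Lemma diff_order_comp i j u v :
  (forall x y, u (x - y) = u x - u y) ->
  diff_order i u -> diff_order j v -> diff_order (i + j) (u \o v).
Proof.
move: {2}(i + j)%N (leqnn (i + j)%N) => n; elim: n => [|n IH] in i j u v *.
  rewrite leqn0 addn_eq0 => /andP[/eqP-> /eqP->] _ hu hv a x /=.
  by move/subr0_eq: (hv a x) => ->; exact: hu.
move=> hij uB hu hv.
have hadd (f g : O -> O) k : diff_order k f -> diff_order k g ->
    diff_order k (fun x => f x + g x).
  move=> hf hg; have := diff_orderP 1 hf hg; congr diff_order.
  by apply/funext => x; rewrite scale1r.
have E a : (fun x => (u \o v) (a * x) - a * (u \o v) x) =
    (fun x => (u \o (fun x => v (a * x) - a * v x)) x +
              ((fun x => u (a * x) - a * u x) \o v) x).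
  by apply/funext => x /=; rewrite uB addrA subrK.
have uaB a x y : (u (a * (x - y)) - a * u (x - y)) =
    (u (a * x) - a * u x) - (u (a * y) - a * u y).
  by rewrite mulrBr !uB mulrBr !opprD !opprK addrACA.
have h1 a j' : j = j'.+1 ->
    diff_order (i + j') (u \o (fun x => v (a * x) - a * v x)).
  move=> ej; apply: IH => //; first by rewrite -ltnS -addnS -ej.
  by move: hv; rewrite ej; apply.
have h2 a i' : i = i'.+1 ->
    diff_order (i' + j) ((fun x => u (a * x) - a * u x) \o v).
  move=> ei; apply: IH => //; first by rewrite -ltnS -addSn -ei.
  by move: hu; rewrite ei; apply.
have u0 : u 0 = 0 by rewrite -[in LHS](subrr 0) uB subrr.
case: i j => [|i] [|j] in hij hu hv h1 h2 *.
- move=> a x /=; move/subr0_eq: (hv a x) => ->; exact: hu.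
- move=> a; rewrite E; apply: hadd; first exact: h1.
  have -> : ((fun x => u (a * x) - a * u x) \o v) = fun=> 0.
    by apply/funext => x /=; exact: hu.
  by apply: (diff_order_le (leq0n _)) => b y; rewrite mulr0 subr0.
- rewrite addn0 => a; rewrite E; apply: hadd; last first.
    by have := h2 a _ erefl; rewrite addn0.
  have -> : (u \o (fun x => v (a * x) - a * v x)) = fun=> 0.
    by apply/funext => x /=; rewrite (hv a x) u0.
  by apply: (diff_order_le (leq0n _)) => b y; rewrite mulr0 subr0.
- rewrite addSn => a; rewrite E; apply: hadd; last exact: h2.
  by have := h1 a _ erefl; rewrite addSn -addnS.
Qed.

Definition diffop_pred : {pred O -> O} := fun u => `[< is_diffop u >].

Fact diffop_submod : submod_closed diffop_pred.
Proof.
split.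
  apply/asboolP; split=> [c x y|]; first by rewrite /= scaler0 addr0.
  by exists 0%N => a x /=; rewrite mulr0 subr0.
move=> c u v /asboolP[ul [i hu]] /asboolP[vl [j hv]]; apply/asboolP; split.
  move=> d x y; rewrite -[LHS]/(c *: u (d *: x + y) + v (d *: x + y)) ul vl.
  rewrite -[in RHS]/(d *: (c *: u x + v x) + (c *: u y + v y)).
  by rewrite !scalerDr !scalerA (mulrC c d) addrACA.
exists (maxn i j); apply: (@diff_orderP _ c u v).
  exact: diff_order_le (leq_maxl _ _) hu.
exact: diff_order_le (leq_maxr _ _) hv.
Qed.

HB.instance Definition _ :=
  GRing.isSubmodClosed.Build K (O -> O) diffop_pred diffop_submod.

End DiffopTheory.

(* The ring of differential operators D(O), as a subalgebra of End_K(O). *)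
Record diffop (K : fieldType) (O : comAlgType K) := Diffop {
  diffop_fun :> O -> O;
  _ : diffop_fun \in @diffop_pred K O
}.

Section DiffopAlgebra.
Variables (K : fieldType) (O : comAlgType K).

HB.instance Definition _ := [isSub for @diffop_fun K O].
HB.instance Definition _ := [Choice of diffop O by <:].
HB.instance Definition _ := [SubChoice_isSubLmodule of diffop O by <:].

Fact diffopP (u : diffop O) : is_diffop u.
Proof. by apply/asboolP; exact: valP u. Qed.

Fact diffop1_subproof : (id : O -> O) \in @diffop_pred K O.
Proof.
by apply/asboolP; split=> //; exists 0%N => a x; rewrite subrr.
Qed.

Fact diffopM_subproof (u v : diffop O) :
  (diffop_fun u \o diffop_fun v) \in @diffop_pred K O.
Proof.
have [ul [i hu]] := diffopP u; have [vl [j hv]] := diffopP v.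
apply/asboolP; split=> [c x y|] /=; first by rewrite vl ul.
exists (i + j)%N; apply: diff_order_comp => // x y.
by rewrite addrC -scaleN1r ul scaleN1r addrC.
Qed.

Definition diffop_one : diffop O := Diffop diffop1_subproof.
Definition diffop_mul (u v : diffop O) : diffop O :=
  Diffop (diffopM_subproof u v).

Fact diffop_mulA : associative diffop_mul.
Proof. by move=> u v w; apply: val_inj. Qed.
Fact diffop_mul1 : left_id diffop_one diffop_mul.
Proof. by move=> u; apply: val_inj. Qed.
Fact diffop_mulr1 : right_id diffop_one diffop_mul.
Proof. by move=> u; apply: val_inj. Qed.
Fact diffop_mulDl : left_distributive diffop_mul +%R.
Proof. by move=> u v w; apply: val_inj. Qed.
Fact diffop_mulDr : right_distributive diffop_mul +%R.
Proof.
move=> u v w; apply: val_inj; apply/funext => x /=.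
have [ul _] := diffopP u.
by have := ul 1 (v x) (w x); rewrite !scale1r.
Qed.
Fact diffop_one_neq0 : diffop_one != 0.
Proof.
apply/eqP => /(congr1 val)/(congr1 (fun f : O -> O => f 1)) /= /eqP.
by rewrite oner_eq0.
Qed.

HB.instance Definition _ := GRing.Zmodule_isNzRing.Build (diffop O)
  diffop_mulA diffop_mul1 diffop_mulr1 diffop_mulDl diffop_mulDr
  diffop_one_neq0.

Fact diffop_scaleAl (c : K) (u v : diffop O) : c *: (u * v) = (c *: u) * v.
Proof. by apply: val_inj. Qed.
HB.instance Definition _ :=
  GRing.Lmodule_isLalgebra.Build K (diffop O) diffop_scaleAl.

Fact diffop_scaleAr (c : K) (u v : diffop O) : c *: (u * v) = u * (c *: v).
Proof.
apply: val_inj; apply/funext => x /=; have [ul _] := diffopP u.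
have u0 : u 0 = 0 by apply/eqP; have := ul 1 0 0;
  rewrite !scale1r addr0 => /eqP; rewrite -subr_eq0 opprD addNKr oppr_eq0.
by have := ul c (v x) 0; rewrite !addr0 u0 addr0.
Qed.
HB.instance Definition _ :=
  GRing.Lalgebra_isAlgebra.Build K (diffop O) diffop_scaleAr.

End DiffopAlgebra.

Definition ideal_gen (S : comPzRingType) (s : nat) (f : 'I_s -> S) : set S :=
  [set p | exists c : 'I_s -> S, p = \sum_(i < s) c i * f i].

(* The closed subscheme f_1 = ... = f_s = 0 of the affine space A^m over K,
   together with its coordinate ring O(X) = K[x_1, ..., x_m] / (f_1, ..., f_s)
   (given up to isomorphism). *)
Record affine_scheme (K : fieldType) := AffineScheme {
  ambient_dim : nat;
  nb_equations : nat;
  equations : 'I_nb_equations -> mpoly.mpoly ambient_dim K;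
  regfun : comAlgType K;
  regfun_proj : {lrmorphism mpoly.mpoly ambient_dim K -> regfun};
  regfun_proj_surj : forall g, exists p, regfun_proj p = g;
  regfun_proj_ker : forall p, regfun_proj p = 0 <-> ideal_gen equations p
}.

(* X is irreducible and reduced. *)
Definition irreducible_variety (K : fieldType) (X : affine_scheme K) : Prop :=
  forall g h : regfun X, g * h = 0 -> g = 0 \/ h = 0.

Definition prime_ideal (S : comPzRingType) (I : set S) : Prop :=
  [/\ I 0, forall x y, I x -> I y -> I (x + y),
      forall a x, I x -> I (a * x), ~ I 1 &
      forall x y, I (x * y) -> I x \/ I y].

Definition prime_chain (S : comPzRingType) (n : nat) : Prop :=
  exists p : nat -> set S, (forall i, (i <= n)%N -> prime_ideal (p i)) /\
    forall i, (i < n)%N -> p i `<` p i.+1.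

Definition krull_dim (S : comPzRingType) (n : nat) : Prop :=
  prime_chain S n /\ ~ prime_chain S n.+1.

Definition variety_dim (K : fieldType) (X : affine_scheme K) (n : nat)
    : Prop :=
  krull_dim (regfun X) n.

Definition eval_at (K L : fieldType) (iota : {rmorphism K -> L}) (m : nat)
    (x : 'I_m -> L) (p : mpoly.mpoly m K) : L :=
  mpoly.mmap iota x p.

Definition jacobian_at (K L : fieldType) (iota : {rmorphism K -> L})
    (X : affine_scheme K) (x : 'I_(ambient_dim X) -> L)
    : 'M[L]_(nb_equations X, ambient_dim X) :=
  \matrix_(i, j) eval_at iota x (mpoly.mderiv j (equations i)).

(* Smoothness of X of dimension n over K: at every point of X with
   coordinates in an extension field L of K, the tangent space (the kernel of
   the Jacobian matrix) has dimension n, i.e. the matrix has rank m - n. *)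
Definition smooth (K : fieldType) (X : affine_scheme K) (n : nat) : Prop :=
  forall (L : fieldType) (iota : {rmorphism K -> L})
    (x : 'I_(ambient_dim X) -> L),
  (forall i, eval_at iota x (equations i) = 0) ->
  (\rank (jacobian_at iota x) + n = ambient_dim X)%N.

(* Main.v *)
Require Import Defs.
From HB Require Import structures.
From mathcomp Require Import all_boot all_order all_algebra.
From mathcomp Require Import sesquilinear generic_quotient ring_quotient.
From mathcomp Require Import all_classical all_reals all_analysis.
From mathcomp Require Import ring.
From mathcomp Require Import (canonicals, coercions) mpoly.

(* On the open set where an r x r minor D of the Jacobian matrix is invertible
   (r = m - n), the n remaining coordinates y have dual derivations d/dy_i, and
   D d/dy_i is globally defined. By smoothness the minors generate the unit
   ideal of O(X). Since i D u - sum_j [u, y_j] D d/dy_j has order less than i for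
   u of order i, the ring D(X) is generated by O(X) and these derivations.

   An operator of order i is determined by its values on the monomials of degree
   at most i in y, and dim O(X)_i = O(i^n), because a transcendence basis among
   the coordinates has dual derivations, which lie in the kernel of the Jacobian
   matrix; hence GK(D(X)) <= 2n. The operators y^a D^(2N) (d/dy)^b are linearly
   independent, hence GK(D(X)) >= 2n. If v <> 0 is an element of a D(X)-module,
   some minor D has D^j v <> 0 for all j. Let u <> 0 be a combination of
   the y^a D^(2N) (d/dy)^b with |a|, |b| <= N. A number of commutators of u which
   is linear in N yields a nonzero multiple of a power of D. So u does not vanish
   on the span of the products of O(N) generators applied to v, and as in
   Bernstein's inequality for the Weyl algebra the square of the dimension of
   that span is bounded below by a multiple of N^(2n).

   Let p and q be finite families of elements of P and Q with sum_l q_l p_l = 1.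
   Both bounds pass from D(X) to A through the maps d -> p_k d q_l, by
   p d d' q = sum_l (p d q_l) (p_l d' q). *)

Import GRing.Theory Num.Theory.
Local Open Scope ring_scope.

(** * Dimension of subspaces *)

Section LinearDimension.
Set Implicit Arguments.
Unset Strict Implicit.
Local Open Scope classical_set_scope.

(** Two obstacles shape the proof. The coordinates y generate only a polynomial subring K[y] of
    O(X), and O(X) itself carries no degree in y. Degrees of operators are therefore measured on
    K[y] alone, where the operators in question act as a fixed power of D times a polynomial
    operator; the common exponent 2N makes this stable under linear combinations. It is twice the
    order because D^2 d/dy_i, corrected by a function, maps D^(2j) g exactly to D^(2j+2) dg/dy_i for
    g in K[y]. Moreover v may be killed by a power of a given minor, so the chart has to be adapted
    to v.

    The bound for an A-module M has to land in the filtration of M itself. For this reason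
    Bernstein's argument is stated for a linear map [nu] on D(X) whose kernel is a left ideal, with
    values in any vector space, such as a power of M.

    [GK_alg] and [GK_mod] select a value among all choices of generators, so the bounds are proved
    for arbitrary generators. *)

Definition lin_subspace (F : pzRingType) (V : lmodType F) (U : set V) : Prop :=
  U 0 /\ forall c u v, U u -> U v -> U (c *: u + v).

Section Span.
Variables (F : pzRingType) (V : lmodType F).
Implicit Types (U S : set V).

Lemma subspaceD U u v : lin_subspace U -> U u -> U v -> U (u + v).
Proof. by move=> [_ UP] Uu Uv; rewrite -[u]scale1r; exact: UP. Qed.

Lemma subspaceZ U c u : lin_subspace U -> U u -> U (c *: u).
Proof. by move=> [U0 UP] Uu; rewrite -[_ *: _]addr0; exact: UP. Qed.

Lemma subspaceB U u v : lin_subspace U -> U u -> U v -> U (u - v).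
Proof. by move=> [_ UP] Uu Uv; rewrite addrC -scaleN1r; exact: UP. Qed.

Lemma subspace_sum U (I : Type) (r : seq I) (P : pred I) (f : I -> V) :
  lin_subspace U -> (forall i, P i -> U (f i)) -> U (\sum_(i <- r | P i) f i).
Proof.
move=> subU Uf; elim/big_rec: _ => [|i x Pi Ux]; first exact: subU.1.
exact: subspaceD (Uf i Pi) Ux.
Qed.

Lemma subspace_forall (I : Type) (U : I -> set V) :
  (forall i, lin_subspace (U i)) -> lin_subspace [set u | forall i, U i u].
Proof.
move=> subU; split=> [i|c u v Uu Uv i]; first exact: (subU i).1.
exact: (subU i).2.
Qed.

Lemma lin_span_subspace S : lin_subspace (lin_span S).
Proof.
split; first by exists 0%N, (fun=> 0), (fun=> 0); split=> [[]|]; rewrite ?big_ord0.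
move=> a _ _ [k [c [w [Sw ->]]]] [l [d [z [Sz ->]]]].
exists (k + l)%N,
  (fun i => match fintype.split i with inl i => a * c i | inr i => d i end),
  (fun i => match fintype.split i with inl i => w i | inr i => z i end).
split=> [i|]; first by case: (fintype.split i).
rewrite big_split_ord /= scaler_sumr; congr (_ + _); apply: eq_bigr => i _.
  by rewrite (unsplitK (inl i)) scalerA.
by rewrite (unsplitK (inr i)).
Qed.

Lemma sub_lin_span S : S `<=` lin_span S.
Proof.
move=> x Sx; exists 1%N, (fun=> 1), (fun=> x); split=> //.
by rewrite big_ord1 scale1r.
Qed.

Lemma lin_span_min U S : lin_subspace U -> S `<=` U -> lin_span S `<=` U.
Proof.
move=> subU SU _ [k [c [w [Sw ->]]]]; apply: subspace_sum => // i _.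
by apply: subspaceZ => //; exact: SU.
Qed.

Lemma lin_spanS S S' : S `<=` S' -> lin_span S `<=` lin_span S'.
Proof.
move=> SS'; apply: lin_span_min; first exact: lin_span_subspace.
by move=> x /SS'; exact: sub_lin_span.
Qed.

Lemma lin_span_range (I : finType) (w : I -> V) x :
  lin_span (range w) x <-> exists c : I -> F, x = \sum_i c i *: w i.
Proof.
split=> [|[c ->]]; last first.
  apply: subspace_sum; first exact: lin_span_subspace.
  move=> i _; apply: subspaceZ; first exact: lin_span_subspace.
  by apply: sub_lin_span; exists i.
apply: (@lin_span_min [set x | exists c : I -> F, x = \sum_i c i *: w i]).
  split; first by exists (fun=> 0); rewrite big1 // => i _; rewrite scale0r.
  move=> a _ _ [c ->] [d ->]; exists (fun i => a * c i + d i).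
  rewrite scaler_sumr -big_split; apply: eq_bigr => i _.
  by rewrite scalerDl scalerA.
move=> _ [i _ <-]; exists (fun j => (j == i)%:R).
rewrite (bigD1 i) //= eqxx scale1r big1 ?addr0 // => j /negPf ->.
by rewrite scale0r.
Qed.

End Span.

Definition linear_fun (F : pzRingType) (V W : lmodType F) (T : V -> W) : Prop :=
  forall c u v, T (c *: u + v) = c *: T u + T v.

Lemma linear_fun0 (F : pzRingType) (V W : lmodType F) (T : V -> W) :
  linear_fun T -> T 0 = 0.
Proof.
by move=> linT; have := linT (-1) 0 0; rewrite scaler0 addr0 scaleN1r addNr.
Qed.

Lemma linear_fun_sum (F : pzRingType) (V W : lmodType F) (T : V -> W)
    (I : Type) (r : seq I) (P : pred I) (c : I -> F) (f : I -> V) :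
  linear_fun T -> T (\sum_(i <- r | P i) c i *: f i) =
  \sum_(i <- r | P i) c i *: T (f i).
Proof.
move=> linT; elim/big_rec2: _ => [|i x y _ <-]; first exact: linear_fun0.
exact: linT.
Qed.

Lemma subspace_preim (F : pzRingType) (V W : lmodType F) (T : V -> W)
    (U : set W) :
  linear_fun T -> lin_subspace U -> lin_subspace [set x | U (T x)].
Proof.
move=> linT subU; split=> [|c u v] /=.
  by rewrite linear_fun0 //; exact: subU.1.
by rewrite linT; exact: subU.2.
Qed.

Lemma linear_fun_mulr (F : pzRingType) (A : lalgType F) (y : A) :
  linear_fun (fun x : A => x * y).
Proof. by move=> c u v; rewrite mulrDl scalerAl. Qed.

Lemma linear_fun_mull (F : pzRingType) (A : algType F) (y : A) :
  linear_fun (fun x : A => y * x).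
Proof. by move=> c u v; rewrite mulrDr scalerAr. Qed.

Variable (F : fieldType).

(** Phrased by independent families, so that it is monotone in [U] and meaningful before a basis is
    known; [basis_exists] then provides one. *)
Definition dim_le (V : lmodType F) (U : set V) (d : nat) : Prop :=
  forall k (v : 'I_k -> V), lin_indep v -> (forall i, U (v i)) -> (k <= d)%N.

Lemma dim_leW (V : lmodType F) (U U' : set V) (d d' : nat) :
  U `<=` U' -> (d' <= d)%N -> dim_le U' d' -> dim_le U d.
Proof.
move=> UU' dd' hU' k v vi vU; apply: leq_trans dd'; apply: hU' vi _ => i.
exact: UU'.
Qed.

(** The coordinates of all images under the [T j] turn an independent family in [U] into the rows of
    a matrix with |J| |I| columns, and joint injectivity makes these rows free. Dimension estimates
    below are obtained by exhibiting such maps. *)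
Lemma dim_le_joint_span (V W : lmodType F) (J I : finType) (U : set V)
    (T : J -> V -> W) (w : I -> W) :
  lin_subspace U -> (forall j, linear_fun (T j)) ->
  (forall j u, U u -> lin_span (range w) (T j u)) ->
  (forall u, U u -> (forall j, T j u = 0) -> u = 0) ->
  dim_le U (#|J| * #|I|).
Proof.
move=> subU linT Tw Tinj k v vi vU.
have /choice[C hC] (s : 'I_k * J) : exists c : I -> F,
    T s.2 (v s.1) = \sum_i c i *: w i.
  by have /lin_span_range := Tw s.2 _ (vU s.1).
have <- : #|{: J * I}| = (#|J| * #|I|)%N by rewrite card_prod.
pose M := \matrix_(i < k, s < #|{: J * I}|)
  C (i, (enum_val s).1) (enum_val s).2.
have : row_free M; last first.
  by rewrite -row_leq_rank => /leq_trans; apply; exact: rank_leq_col.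
rewrite -kermx_eq0; apply/rowV0P => u /sub_kermxP uM.
apply/rowP => i; rewrite mxE; apply: (vi (u 0)).
apply: Tinj => [|j].
  by apply: subspace_sum => // i' _; apply: subspaceZ.
rewrite linear_fun_sum //.
under eq_bigr => i' _ do rewrite (hC (i', j)) scaler_sumr.
rewrite exchange_big /= big1 // => t _.
under eq_bigr => i' _ do rewrite scalerA.
rewrite -scaler_suml; have /rowP/(_ (enum_rank (j, t))) := uM.
rewrite !mxE; under eq_bigr => i' _ do rewrite mxE enum_rankK.
by move=> ->; rewrite scale0r.
Qed.

Lemma dim_le_span (V : lmodType F) (I : finType) (w : I -> V) :
  dim_le (lin_span (range w)) #|I|.
Proof.
rewrite -[#|I|]mul1n -card_unit.
apply: (@dim_le_joint_span _ _ _ _ _ (fun _ : unit => idfun) w) => //.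
  exact: lin_span_subspace.
by move=> u _ /(_ tt).
Qed.

Lemma lin_indep_rcons (V : lmodType F) k (v : 'I_k -> V) (x : V) :
  lin_indep v -> ~ lin_span (range v) x ->
  lin_indep (fun i : 'I_k.+1 => if unlift ord_max i is Some j then v j else x).
Proof.
move=> vi nx c; rewrite big_ord_recr /= unlift_none.
have wE i : widen_ord (leqnSn k) i = lift ord_max i.
  by apply/val_inj; rewrite /= /bump leqNgt ltn_ord.
under eq_bigr => i _ do rewrite wE liftK.
move=> E; have [c0|cn0] := eqVneq (c ord_max) 0.
  move: E; rewrite c0 scale0r addr0 => /vi c'0 i.
  by have [j ->|->] := unliftP ord_max i; first exact: c'0.
case: nx; apply/lin_span_range.
exists (fun i => - (c ord_max)^-1 * c (lift ord_max i)).
rewrite -[x]scale1r -(mulVf cn0) -scalerA.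
have /eqP := E; rewrite addrC addr_eq0 => /eqP ->.
rewrite scalerN -scaleNr scaler_sumr.
by apply: eq_bigr => i _; rewrite scalerA.
Qed.

Lemma basis_exists (V : lmodType F) (U : set V) d :
  lin_subspace U -> dim_le U d -> exists2 e, (e <= d)%N & has_lin_dim U e.
Proof.
move=> subU Ud.
pose P e := `[< exists v : 'I_e -> V, lin_indep v /\ forall i, U (v i) >].
have P0 : exists e, P e.
  exists 0%N; apply/asboolP; exists (fun=> 0); split=> [c _ []//|[]//].
have Pd e : P e -> (e <= d)%N by move=> /asboolP[v [vi vU]]; exact: Ud vi vU.
case: (ex_maxnP P0 Pd) => e /asboolP[v [vi vU]] emax.
exists e; first by apply: Pd; apply/asboolP; exists v.
exists v; split=> //; apply/seteqP; split=> x.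
  move=> Ux; apply: contrapT => nx.
  suff /emax : P e.+1 by rewrite ltnn.
  apply/asboolP; eexists; split; first exact: (lin_indep_rcons vi nx).
  by move=> i /=; case: (unlift ord_max i) => [j|] //; exact: vU.
by apply: lin_span_min => // _ [i _ <-].
Qed.

Lemma dim_le_has (V : lmodType F) (U : set V) e :
  has_lin_dim U e -> dim_le U e.
Proof. by move=> [v [_ ->]]; have := @dim_le_span V 'I_e v; rewrite card_ord. Qed.

Lemma lin_dim_leP (V : lmodType F) (U : set V) d :
  lin_subspace U -> dim_le U d -> (lin_dim U <= d)%N /\ dim_le U (lin_dim U).
Proof.
move=> subU Ud; have [e led hU] := basis_exists subU Ud.
have hd : has_lin_dim U (lin_dim U).
  by have := xgetPex 0%N (ex_intro [set e | has_lin_dim U e] e hU).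
split; last exact: dim_le_has.
have [v [vi Uv]] := hd; apply: Ud vi _ => i; rewrite Uv.
by apply: sub_lin_span; exists i.
Qed.

Lemma dim_le_joint (V W : lmodType F) (J : finType) (U : set V) (U' : set W)
    (T : J -> V -> W) e :
  lin_subspace U -> lin_subspace U' -> (forall j, linear_fun (T j)) ->
  dim_le U' e -> (forall j u, U u -> U' (T j u)) ->
  (forall u, U u -> (forall j, T j u = 0) -> u = 0) ->
  dim_le U (#|J| * e).
Proof.
move=> subU subU' linT U'e TU Tinj.
have [e' le' [w [_ U'w]]] := basis_exists subU' U'e.
apply: (@dim_leW _ U U _ (#|J| * e')%N) => //; first by rewrite leq_mul2l le' orbT.
rewrite -[e']card_ord; apply: (@dim_le_joint_span _ _ _ _ _ T w) => //.
by move=> j u /(TU j); rewrite U'w.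
Qed.

Lemma indep_card (V : lmodType F) (I : finType) (v : I -> V) (U : set V) d :
  dim_le U d -> (forall i, U (v i)) ->
  (forall c : I -> F, \sum_i c i *: v i = 0 -> forall i, c i = 0) ->
  (#|I| <= d)%N.
Proof.
move=> Ud Uv vi; apply: (Ud _ (v \o enum_val)) => [c|i]; last exact: Uv.
move=> E i; rewrite -[i]enum_valK; apply: (vi (c \o enum_rank)).
rewrite -[RHS]E (reindex _ (onW_bij _ (@enum_val_bij I))) /=.
by apply: eq_bigr => j _; rewrite enum_valK.
Qed.

End LinearDimension.

(** * Growth *)

Section Growth.
Set Implicit Arguments.
Unset Strict Implicit.
Import Order.TTheory.
Variable R : realType.
Implicit Types f : nat -> nat.

Lemma growth_le f C N :
  (forall i, f i <= C * i.+1 ^ N)%N -> (growth R f <= N%:R%:E)%E.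
Proof.
move=> fC; apply/lee_addgt0Pr => e e0; apply: ge_ereal_inf.
exists (N%:R + e)%:E => //; exists (N%:R + e) => //=.
(* i + 1 <= 2 i yields the factor 2 ^ N; for i >= B ^ (1/e) the constant B is absorbed into i ^
   e. *)
pose B : R := (C * 2 ^ N)%:R.
near=> i.
have i1 : (0 < i)%N by near: i; exact: nbhs_infty_gt.
have iR : 0 < i%:R :> R by rewrite ltr0n.
have le1 : (f i)%:R <= B * i%:R ^+ N.
  rewrite -natrX -natrM ler_nat; apply: leq_trans (fC i) _.
  rewrite -mulnA -expnMn leq_mul2l; apply/orP; right.
  have [->|N0] := posnP N; first by rewrite !expn0.
  by rewrite leq_exp2r // mul2n -addnn -addn1 leq_add2l.
apply: le_trans le1 _; rewrite powRD; last by rewrite (gt_eqF iR) implybT.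
rewrite mulrC powR_mulrn ?ler0n // ler_wpM2l ?exprn_ge0 //.
have -> : B = (B `^ e^-1) `^ e.
  by rewrite -powRrM mulVf ?gt_eqF // powRr1 // ler0n.
apply: ge0_ler_powR; rewrite ?nnegrE ?powR_ge0 ?ler0n ?(ltW e0) //.
near: i; exact: nbhs_infty_ger.
Unshelve. all: by end_near. Qed.

(** Multiples of c suffice: an exponent r < n valid for all large arguments would give k ^ n <= L c
    ^ r k ^ r for all large k. *)
Lemma growth_ge f c L n : (0 < c)%N ->
  (forall i, i.+1 ^ n <= L * f (c * i.+1))%N -> (n%:R%:E <= growth R f)%E.
Proof.
move=> c0 fL; apply: le_ereal_inf_tmp => _ [r fr <-]; rewrite lee_fin.
rewrite leNgt; apply/negP => rn.
pose B : R := L%:R * c%:R `^ r.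
have nr0 : 0 < n%:R - r by rewrite subr_gt0.
have [N _ fN] := fr.
(* Large enough for [fN] to apply at [c * k.+1] and for B < k.+1 ^ (n - r). *)
pose k := maxn N (Num.trunc (B `^ (n%:R - r)^-1)).
have kR : 0 < k.+1%:R :> R by rewrite ltr0n.
have cR : 0 < c%:R :> R by rewrite ltr0n.
have h1 : B < k.+1%:R `^ (n%:R - r).
  have B0 : 0 <= B by rewrite mulr_ge0 ?ler0n ?powR_ge0.
  have -> : B = (B `^ (n%:R - r)^-1) `^ (n%:R - r).
    by rewrite -powRrM mulVf ?gt_eqF // powRr1.
  apply: gt0_ltr_powR; rewrite ?nnegrE ?powR_ge0 ?ler0n //.
  apply: lt_le_trans (truncnS_gt _) _; by rewrite ler_nat ltnS leq_maxr.
have h2 : k.+1%:R ^+ n <= B * k.+1%:R `^ r.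
  rewrite -natrX; apply: (@le_trans _ _ (L * f (c * k.+1))%:R).
    by rewrite ler_nat fL.
  rewrite natrM -mulrA -powRM ?ler0n // ler_wpM2l // -natrM; apply: fN => /=.
  apply: leq_trans (leq_maxl _ _) _; apply: leq_trans (leqnSn _) _.
  exact: leq_pmull.
have : B * k.+1%:R `^ r < k.+1%:R ^+ n.
  rewrite -powR_mulrn ?ler0n // -[n%:R](subrK r) powRD; last first.
    by rewrite (gt_eqF kR) implybT.
  by rewrite ltr_pM2r // powR_gt0.
by rewrite ltNge h2.
Qed.

End Growth.

(** * Filtrations and Morita contexts *)

Section Filtration.
Set Implicit Arguments.
Unset Strict Implicit.
Local Open Scope classical_set_scope.
Variables (K : fieldType) (A : algType K).
Implicit Types (a : seq A) (x y : A).

Lemma filt_subspace a i : lin_subspace (alg_filtration a i).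
Proof. by case: i => [|i]; exact: lin_span_subspace. Qed.

Lemma filtS a i x y : lin_span (1 |` [set` a]) x -> alg_filtration a i y ->
  alg_filtration a i.+1 (x * y).
Proof. by move=> ax ay; apply: sub_lin_span; exists x, y. Qed.

Lemma filt_leS a i x : alg_filtration a i x -> alg_filtration a i.+1 x.
Proof.
move=> ax; rewrite -[x]mul1r; apply: filtS => //.
by apply: sub_lin_span; left.
Qed.

Lemma filt_le a i j x : (i <= j)%N -> alg_filtration a i x ->
  alg_filtration a j x.
Proof.
by move=> /subnK <- ax; elim: (j - i)%N => // k; rewrite addSn; exact: filt_leS.
Qed.

Lemma filt1 a i : alg_filtration a i 1.
Proof. by apply: (@filt_le _ 0%N) => //; exact: sub_lin_span. Qed.

Lemma filt_ind a (U : set A) : lin_subspace U -> U 1 ->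
  (forall x y, x \in a -> U y -> U (x * y)) ->
  forall i, alg_filtration a i `<=` U.
Proof.
move=> subU U1 Ua; elim=> [|i IH]; first by apply: lin_span_min => // _ ->.
apply: lin_span_min => // _ [x [y [ax /IH Uy ->]]].
move: x ax; apply: (@lin_span_min _ _ [set x | U (x * y)]).
  exact: subspace_preim (linear_fun_mulr y) subU.
by move=> z [->|za] /=; [rewrite mul1r | exact: Ua].
Qed.

Lemma filtM a i j x y : alg_filtration a i x -> alg_filtration a j y ->
  alg_filtration a (i + j) (x * y).
Proof.
elim: i x => [|i IH] x.
  move=> ax ay; move: x ax.
  apply: (@lin_span_min _ _ [set x | alg_filtration a (0 + j) (x * y)]).
    split=> [|c u v] /=; first by rewrite mul0r; exact: (filt_subspace _ _).1.
    by rewrite mulrDl -scalerAl; exact: (filt_subspace _ _).2.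
  by move=> _ -> /=; rewrite mul1r.
move=> ax ay; move: x ax.
apply: (@lin_span_min _ _ [set x | alg_filtration a (i.+1 + j) (x * y)]).
  apply: subspace_preim; [exact: linear_fun_mulr | exact: filt_subspace].
move=> _ [x1 [x2 [ax1 ax2 ->]]]; rewrite /mkset addSn -mulrA; apply: filtS => //.
exact: IH.
Qed.

Lemma filt_gen a x : x \in a -> alg_filtration a 1 x.
Proof.
move=> xa; rewrite -[x]mulr1; apply: filtS; last exact: filt1.
by apply: sub_lin_span; right.
Qed.

Lemma filtX a i x k : alg_filtration a i x -> alg_filtration a (i * k) (x ^+ k).
Proof.
move=> ax; elim: k => [|k IH]; first exact: filt1.
by rewrite exprS mulnS; exact: filtM.
Qed.

Lemma filt_spanned a i : exists (I : finType) (w : I -> A),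
  alg_filtration a i `<=` lin_span (range w).
Proof.
elim: i => [|i [I [w aw]]].
  by exists unit, (fun=> 1); apply: lin_spanS => _ ->; exists tt.
exists ('I_(size (1 :: a)) * I)%type,
  (fun s : 'I_(size (1 :: a)) * I => (1 :: a)`_s.1 * w s.2).
apply: lin_span_min; first exact: lin_span_subspace.
move=> _ [x [y [ax /aw wy ->]]].
move: y wy; apply: (@lin_span_min _ _ [set y | lin_span _ (x * y)]).
  apply: subspace_preim; [exact: linear_fun_mull | exact: lin_span_subspace].
move=> _ [i0 _ <-] /=.
move: x ax; apply: (@lin_span_min _ _ [set x | lin_span _ (x * w i0)]).
  apply: subspace_preim; [exact: linear_fun_mulr | exact: lin_span_subspace].
move=> x xa; apply: sub_lin_span.
have {}xa : x \in 1%R :: a by case: xa => /= xa; rewrite in_cons ?xa ?eqxx ?orbT.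
have xi : (index x (1%R :: a) < size (1%R :: a))%N by rewrite index_mem.
by exists (Ordinal xi, i0) => //=; rewrite nth_index.
Qed.

Lemma filt_dim_le a i : exists d, dim_le (alg_filtration a i) d.
Proof.
have [I [w aw]] := filt_spanned a i; exists #|I|.
by apply: dim_leW aw (leqnn _) _; apply: dim_le_span.
Qed.

Lemma alg_generates_filt a (I : finType) (z : I -> A) : alg_generates a ->
  exists c, forall i, alg_filtration a c (z i).
Proof.
move=> aT; have /choice[f hf] i : exists c, alg_filtration a c (z i).
  by have : [set: A] (z i) by []; rewrite -aT => -[c _]; exists c.
exists (\max_i f i)%N => i; apply: filt_le (hf i); exact: leq_bigmax.
Qed.

End Filtration.

(** * Sandwiching by a Morita context *)

Section Morita.
Set Implicit Arguments.
Unset Strict Implicit.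
Local Open Scope classical_set_scope.
Variables (K : fieldType).

(** With it, an estimate proved from [B] to [A] also serves from [A] to [B]. *)
Definition morita_swap (A B : algType K) (C : morita_context A B) :
    morita_context B A :=
  MoritaContext (@mBQ1 _ _ _ C) (@mQA1 _ _ _ C) (@mAP1 _ _ _ C) (@mPB1 _ _ _ C)
    (@mBBQ _ _ _ C) (@mBQA _ _ _ C) (@mQAA _ _ _ C) (@mAAP _ _ _ C)
    (@mAPB _ _ _ C) (@mPBB _ _ _ C) (@mBQP _ _ _ C) (@mQAP _ _ _ C)
    (@mQPB _ _ _ C) (@mAPQ _ _ _ C) (@mPBQ _ _ _ C)
    (@mPQA _ _ _ C) (@mQPQ _ _ _ C) (@mPQP _ _ _ C).

Definition is_unit_decomp (A B : algType K) (C : morita_context A B)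
    (L : finType) (q : L -> mcQ C) (p : L -> mcP C) : Prop :=
  1 = \sum_l mQP C (q l) (p l).

Lemma unit_decomp_exists (A B : algType K) (C : morita_context A B) :
  lin_span [set mQP C x.1 x.2 | x in [set: mcQ C * mcP C]] = setT ->
  exists (L : finType) (q : L -> mcQ C) (p : L -> mcP C), is_unit_decomp q p.
Proof.
move=> QPT; have : [set: B] 1 by [].
rewrite -QPT => -[k [c [w [wQP e1]]]].
have /choice[f hf] i : exists x : mcQ C * mcP C, mQP C x.1 x.2 = w i.
  by have [x _ <-] := wQP i; exists x.
exists 'I_k, (fun i => c i *: (f i).1), (fun i => (f i).2).
by rewrite /is_unit_decomp e1; apply: eq_bigr => i _; rewrite linearZl_LR hf.
Qed.

Section Context.
Variables (A B : algType K) (C : morita_context A B).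
Implicit Types (p : mcP C) (q : mcQ C).

(** The product p b q in the matrix algebra of the context. *)
Definition sandwich p (b : B) q : A := mPQ C p (mBQ C b q).

Lemma sandwich_linear p q : linear_fun (fun b => sandwich p b q).
Proof. by move=> c u v; rewrite /sandwich linearPl linearPr. Qed.

Variables (L : finType) (q1 : L -> mcQ C) (p1 : L -> mcP C).
Hypothesis one1 : is_unit_decomp q1 p1.

Lemma sandwichM p q b b' :
  sandwich p (b * b') q = \sum_l sandwich p b (q1 l) * sandwich (p1 l) b' q.
Proof.
have e : mBQ C b' q = \sum_l mQA C (q1 l) (sandwich (p1 l) b' q).
  by rewrite -[LHS]mBQ1 one1 linear_sumlz; apply: eq_bigr => l _; rewrite mQPQ.
rewrite [LHS]/sandwich mBBQ e !linear_sumr; apply: eq_bigr => l _.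
by rewrite -mBQA mPQA.
Qed.

(** b = 1 b 1 is the sum of the q_l (p_l b q_l') p_l'. *)
Lemma sandwich_ext b :
  (forall l l', sandwich (p1 l) b (q1 l') = 0) -> b = 0.
Proof.
move=> E; rewrite -[b]mulr1 -[b]mul1r one1 !mulr_suml big1 // => l _.
rewrite mulr_sumr big1 // => l' _.
by rewrite -mulrA -mBQP -mQPB -mPQP -/(sandwich _ _ _) E linear0l linear0r.
Qed.

Lemma sandwich_filt (w : seq B) (a : seq A) p q : alg_generates a ->
  exists c, forall j b, alg_filtration w j b ->
    alg_filtration a (c * j.+1) (sandwich p b q).
Proof.
move=> aT.
(* The first summand holds the generators between members of the families. In the second, [None]
   stands for the given [p] or [q], so that the ends of a product are covered as well. *)
pose z (s : L * (L * 'I_(size (1 :: w))) + (option L * option L)) : A :=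
  match s with
  | inl (l, (l', i)) => sandwich (p1 l) (1%R :: w)`_i (q1 l')
  | inr (l, l') => sandwich (oapp p1 p l) 1 (oapp q1 q l')
  end.
have [c hc] := alg_generates_filt z aT.
have h1 j b : alg_filtration w j b -> forall l,
    alg_filtration a (c * j.+1) (sandwich (p1 l) b q).
  elim: j b => [|j IH].
    apply: (@lin_span_min _ _
      [set b | forall l, alg_filtration a (c * 1) (sandwich (p1 l) b q)])
      => [|_ -> l].
      apply: subspace_forall => l.
      apply: subspace_preim; [exact: sandwich_linear | exact: filt_subspace].
    by rewrite muln1; exact: (hc (inr (Some l, None))).
  apply: (@lin_span_min _ _
    [set b | forall l, alg_filtration a (c * j.+2) (sandwich (p1 l) b q)])
    => [|_ [x [y [wx /IH wy ->]]] l].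
    apply: subspace_forall => l.
    apply: subspace_preim; [exact: sandwich_linear | exact: filt_subspace].
  rewrite sandwichM mulnS; apply: subspace_sum; first exact: filt_subspace.
  move=> l' _; apply: filtM => //.
  move: x wx; apply: (@lin_span_min _ _
    [set x | alg_filtration a c (sandwich (p1 l) x (q1 l'))]).
    apply: subspace_preim; [exact: sandwich_linear | exact: filt_subspace].
  move=> x xw /=; have {}xw : x \in 1%R :: w.
    by case: xw => /= xw; rewrite in_cons ?xw ?eqxx ?orbT.
  have xi : (index x (1%R :: w) < size (1%R :: w))%N by rewrite index_mem.
  by have := hc (inl (l, (l', Ordinal xi))); rewrite /z /= nth_index.
(* One [c] pays for the left factor [sandwich p 1 (q1 l)], the other is the constant of [h1]. *)
exists (c + c)%N => j b /h1 hb; rewrite -[b]mul1r sandwichM.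
apply: subspace_sum; first exact: filt_subspace.
move=> l _; apply: (@filt_le _ _ _ (c + c * j.+1)); last first.
  by apply: filtM => //; exact: (hc (inr (None, Some l))).
by rewrite mulnDl leq_add2r leq_pmulr.
Qed.

(** By [sandwich_ext] the sandwiches embed the step j of [w] into |L|^2 copies of the step c (j + 1)
    of [a]. It is applied both to generators and to [chart_gens], which in general span only a
    subalgebra. *)
Lemma morita_dim (w : seq B) (a : seq A) : alg_generates a ->
  exists c N, forall j e, dim_le (alg_filtration a (c * j.+1)) e ->
    dim_le (alg_filtration w j) (N * e).
Proof.
move=> aT; have /choice[f hf] (s : L * L) := sandwich_filt w (p1 s.1) (q1 s.2) aT.
exists (\max_s f s)%N, #|((L * L)%type : finType)| => j e ae.
apply: (dim_le_joint (T := fun s b => sandwich (p1 s.1) b (q1 s.2)) _ _ _ ae).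
- exact: filt_subspace.
- exact: filt_subspace.
- by move=> s; exact: sandwich_linear.
- move=> s b /hf -/(_ s); apply: filt_le.
  by rewrite leq_mul2r leq_bigmax orbT.
- move=> b _ E; apply: sandwich_ext => l l'; exact: (E (l, l')).
Qed.

(** x = 1 x 1 is the sum of the p_l (q_l x p_l') q_l' over the second family, that is, of sandwiches
    of elements of [B]. The first family splits these along products of generators, so both families
    enter the generators of [A]. *)
Lemma morita_fg (w : seq B) (M : finType) (p2 : M -> mcP C) (q2 : M -> mcQ C) :
  1 = \sum_l mPQ C (p2 l) (q2 l) -> alg_generates w ->
  exists a : seq A, alg_generates a.
Proof.
move=> one2 wT.
pose p (l : L + M) := match l with inl l => p1 l | inr l => p2 l end.
pose q (l : L + M) := match l with inl l => q1 l | inr l => q2 l end.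
pose z (s : (L + M) * ((L + M) * 'I_(size (1 :: w)))) : A :=
  sandwich (p s.1) (1%R :: w)`_s.2.2 (q s.2.1).
exists (codom z); rewrite /alg_generates; set S := \bigcup_i _.
have subS : lin_subspace S.
  split; first by exists 0%N => //; exact: (filt_subspace _ _).1.
  move=> c u v [i _ iu] [j _ jv]; exists (maxn i j) => //.
  apply: (filt_subspace _ _).2; first exact: filt_le (leq_maxl _ _) iu.
  exact: filt_le (leq_maxr _ _) jv.
have SM u v : S u -> S v -> S (u * v).
  by move=> [i _ iu] [j _ jv]; exists (i + j)%N => //; exact: filtM.
have Sz l l' x : x \in 1%R :: w -> S (sandwich (p l) x (q l')).
  move=> xw; have xi : (index x (1%R :: w) < size (1%R :: w))%N by rewrite index_mem.
  exists 1%N => //; apply: filt_gen; apply/codomP.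
  by exists (l, (l', Ordinal xi)); rewrite /z /= nth_index.
have Sp b : forall l l', S (sandwich (p l) b (q l')).
  have : [set: B] b by []; rewrite -wT => -[i _]; move: b.
  apply: (@filt_ind _ _ _ [set b | forall l l', S (sandwich (p l) b (q l'))]).
  - apply: subspace_forall => l; apply: subspace_forall => l'.
    exact: subspace_preim (sandwich_linear _ _) subS.
  - by move=> l l'; apply: Sz; rewrite mem_head.
  - move=> x y xw Sy l l'; rewrite sandwichM.
    apply: subspace_sum => // m _; apply: SM; last exact: (Sy (inl m)).
    by apply: (Sz l (inl m)); rewrite in_cons xw orbT.
apply/seteqP; split=> // x _; rewrite -[x]mulr1 -[x]mul1r one2.
rewrite !mulr_suml; apply: subspace_sum => // l _.
rewrite mulr_sumr; apply: subspace_sum => // l' _.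
have := Sp (mQP C (mQA C (q2 l) x) (p2 l')) (inr l) (inr l').
by rewrite /= /sandwich mQPQ mPQA mPQA.
Qed.

End Context.
End Morita.

(** * Evaluation of polynomials *)

Section PolynomialEvaluation.
Set Implicit Arguments.
Unset Strict Implicit.

Lemma mpoly_ring_ind (n : nat) (R : nzRingType)
    (P : mpoly.mpoly n R -> Prop) :
  (forall c, P (mpoly.mpolyC n c)) ->
  (forall i, P (mpoly.mpolyX R (mpoly.mnm1 i))) ->
  (forall p q, P p -> P q -> P (p + q)) ->
  (forall p q, P p -> P q -> P (p * q)) -> forall p, P p.
Proof.
move=> PC PX PD PM; apply: mpoly.mpolyind; first by rewrite -(mpoly.mpolyC0 n R).
move=> c m p _ _ Pp; apply: (PD) => //; rewrite -mpoly.mul_mpolyC.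
apply: (PM) => //; rewrite mpoly.mpolyXE_id.
elim/big_rec: _ => [|i q _ Pq]; first by rewrite -(mpoly.mpolyC1 n R).
apply: (PM) => //; elim: (m i) => [|k IH]; first by rewrite expr0 -(mpoly.mpolyC1 n R).
by rewrite exprS; exact: PM.
Qed.

Lemma mnm_ind (n : nat) (P : mpoly.multinom n -> Prop) :
  P mpoly.mnm0 -> (forall i m, P m -> P (mpoly.mnm_add m (mpoly.mnm1 i))) ->
  forall m, P m.
Proof.
move=> P0 PS m; move: {2}(mpoly.mdeg m) (erefl (mpoly.mdeg m)) => k.
elim: k m => [|k IH] m mk.
  by move/eqP: mk; rewrite mpoly.mdeg_eq0 => /eqP ->.
have [i mi] : exists i, (0 < m i)%N.
  apply: contrapT => /forallNP m0.
  suff /eqP : mpoly.mdeg m = 0%N by rewrite mk.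
  rewrite mpoly.mdegE big1 // => i _.
  by have /negP := m0 i; rewrite -eqn0Ngt => /eqP.
have im : mpoly.lem (mpoly.mnm1 i) m by rewrite mpoly.lep1mP -lt0n.
rewrite -(mpoly.submK im); apply/PS/IH.
have := mpoly.mdegD (mpoly.mnm_sub m (mpoly.mnm1 i)) (mpoly.mnm1 i).
by rewrite (mpoly.submK im) mk mpoly.mdeg1 addn1 => -[].
Qed.

Variable (K : fieldType).

Definition is_deriv (O : comAlgType K) (d : O -> O) : Prop :=
  linear_fun d /\ forall a b, d (a * b) = d a * b + a * d b.

Section Deriv.
Variables (O : comAlgType K) (d : O -> O).
Hypothesis derd : is_deriv d.

Lemma der0 : d 0 = 0.
Proof. exact: linear_fun0 derd.1. Qed.

Lemma der1 : d 1 = 0.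
Proof.
have := derd.2 1 1; rewrite !mulr1 mul1r => /eqP.
by rewrite -subr_eq0 opprD addrA subrr sub0r oppr_eq0 => /eqP.
Qed.

Lemma derZ c a : d (c *: a) = c *: d a.
Proof. by have := derd.1 c a 0; rewrite !addr0 der0 addr0. Qed.

Lemma derD a b : d (a + b) = d a + d b.
Proof. by have := derd.1 1 a b; rewrite !scale1r. Qed.

Lemma derX a k : d (a ^+ k.+1) = (a ^+ k * d a) *+ k.+1.
Proof.
elim: k => [|k IH]; first by rewrite expr1 expr0 mul1r.
by rewrite exprS derd.2 IH mulrnAr mulrA -exprS mulrC -mulrS.
Qed.

End Deriv.

Definition mpoly_eval (O : comAlgType K) n (y : 'I_n -> O)
    (p : mpoly.mpoly n K) : O := mpoly.mmap (in_alg O) y p.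

Section Eval.
Variables (O : comAlgType K) (n : nat) (y : 'I_n -> O).
Local Notation ev := (mpoly_eval y).

Lemma evalC c : ev (mpoly.mpolyC n c) = c%:A.
Proof. exact: mpoly.mmapC. Qed.

Lemma evalXm m : ev (mpoly.mpolyX K m) = \prod_i y i ^+ m i.
Proof. exact: mpoly.mmapX. Qed.

Lemma evalX i : ev (mpoly.mpolyX K (mpoly.mnm1 i)) = y i.
Proof. by rewrite /mpoly_eval mpoly.mmapX mpoly.mmap1U. Qed.

Lemma evalD p q : ev (p + q) = ev p + ev q.
Proof. exact: mpoly.mmapD. Qed.

Lemma evalB p q : ev (p - q) = ev p - ev q.
Proof. exact: mpoly.mmapB. Qed.

Lemma evalM p q : ev (p * q) = ev p * ev q.
Proof. exact: (rmorphM (mpoly.mmap (in_alg O) y)). Qed.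

Lemma eval1 : ev 1 = 1.
Proof. exact: (rmorph1 (mpoly.mmap (in_alg O) y)). Qed.

Lemma eval0 : ev 0 = 0.
Proof. exact: mpoly.mmap0. Qed.

Lemma evalZ c p : ev (c *: p) = c *: ev p.
Proof. by rewrite /mpoly_eval mpoly.mmapZ /= mulr_algl. Qed.

Lemma eval_sum (I : Type) (r : seq I) (P : pred I) f :
  ev (\sum_(i <- r | P i) f i) = \sum_(i <- r | P i) ev (f i).
Proof. by elim/big_rec2: _ => [|i p q _ <-]; rewrite ?eval0 ?evalD. Qed.

Lemma deriv_eval d p : is_deriv d ->
  d (ev p) = \sum_i ev (mpoly.mderiv i p) * d (y i).
Proof.
move=> derd; elim/mpoly_ring_ind: p => [c|j|p q IHp IHq|p q IHp IHq].
- rewrite evalC derZ // der1 // scaler0 big1 // => i _.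
  by rewrite mpoly.mderivC eval0 mul0r.
- rewrite evalX (bigD1 j) //= big1 => [|i ij].
    rewrite mpoly.mderivX mpoly.mnm1E eqxx.
    rewrite -[X in mpoly.mnm_sub X _]mpoly.add0m mpoly.addmK.
    by rewrite scale1r mpoly.mpolyX0 eval1 mul1r addr0.
  by rewrite mpoly.mderivX mpoly.mnm1E eq_sym (negPf ij) scale0r eval0 mul0r.
- rewrite evalD derD // IHp IHq -big_split; apply: eq_bigr => i _ /=.
  by rewrite mpoly.mderivD evalD mulrDl.
- rewrite evalM derd.2 IHp IHq mulr_suml mulr_sumr -big_split.
  apply: eq_bigr => i _ /=.
  by rewrite mpoly.mderivM evalD !evalM mulrDl mulrAC mulrA.
Qed.

End Eval.

Lemma msize_mderiv n (i : 'I_n) (p : mpoly.mpoly n K) :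
  (mpoly.mmeasure mpoly.mdeg (mpoly.mderiv i p) <=
   (mpoly.mmeasure mpoly.mdeg p).-1)%N.
Proof.
apply: leq_trans (mpoly.mmeasure_sum _ _ _ _) _.
apply/bigmax_leqP_seq => m mp _.
have mlt := mpoly.msize_mdeg_lt mp.
have [->|mi] := eqVneq (m i) 0%N.
  by rewrite mul0r scale0r mpoly.mmeasure0.
apply: leq_trans (mpoly.msizeZ_le _ _) _; rewrite mpoly.msizeX.
have im : mpoly.lem (mpoly.mnm1 i) m by rewrite mpoly.lep1mP.
have := mpoly.mdegD (mpoly.mnm_sub m (mpoly.mnm1 i)) (mpoly.mnm1 i).
rewrite (mpoly.submK im) mpoly.mdeg1 addn1 => <-.
by case: (mpoly.mmeasure _ p) mlt.
Qed.

Lemma msize_mderivm n (m : mpoly.multinom n) (p : mpoly.mpoly n K) :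
  (mpoly.mmeasure mpoly.mdeg (mpoly.mderivm m p) <=
   mpoly.mmeasure mpoly.mdeg p)%N.
Proof.
elim/mnm_ind: m p => [|i m IH] p; first by rewrite mpoly.mderivm0m.
rewrite mpoly.mderivmDm mpoly.mderivmU1m.
by apply: leq_trans (msize_mderiv _ _) _; apply: leq_trans (leq_pred _) (IH p).
Qed.

(** [mmeasure mdeg] is the degree plus one, so the hypothesis says that p is not constant. A
    coefficient of p at a nonzero exponent is multiplied by a positive integer in some
    derivative. *)
Lemma mderiv_neq0 n (p : mpoly.mpoly n K) : [pchar K] =i pred0 ->
  (1 < mpoly.mmeasure mpoly.mdeg p)%N -> exists i, mpoly.mderiv i p != 0.
Proof.
move=> char0 sp; apply: contrapT => /forallNP d0.
suff : p = mpoly.mpolyC n (mpoly.mcoeff mpoly.mnm0 p).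
  by move=> pE; move: sp; rewrite pE mpoly.msizeC; case: eqP.
apply/mpoly.mpolyP => m; rewrite mpoly.mcoeffC.
have [<-|m0] := eqVneq mpoly.mnm0 m; first by rewrite mulr1.
rewrite mulr0; elim/mnm_ind: m m0 => [|i m _ _]; first by rewrite eqxx.
have /negP := d0 i; rewrite negbK => /eqP di.
have := mpoly.mcoeff_mderiv i p m; rewrite di mpoly.mcoeff0 => /esym/eqP.
by rewrite -mulr_natr mulf_eq0 (proj1 (pcharf0P _) char0) orbF => /eqP.
Qed.

End PolynomialEvaluation.

(** * Differential operators and charts *)

Section DifferentialOperators.
Set Implicit Arguments.
Unset Strict Implicit.
Local Open Scope classical_set_scope.
Variables (K : fieldType) (O : comAlgType K).
Hypothesis char0 : [pchar K] =i pred0.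
Implicit Types (u v : diffop O) (a b f : O).

Lemma diffop_ext u v : (forall f, u f = v f) -> u = v.
Proof. by move=> uv; apply/val_inj/funext. Qed.

Lemma diffop_linear u : linear_fun u.
Proof. by have [] := diffopP u. Qed.

Lemma diffopM u v f : (u * v) f = u (v f). Proof. by []. Qed.
Lemma diffopD u v f : (u + v) f = u f + v f. Proof. by []. Qed.
Lemma diffopB u v f : (u - v) f = u f - v f. Proof. by []. Qed.
Lemma diffop0 f : (0 : diffop O) f = 0. Proof. by []. Qed.
Lemma diffopZ c u f : (c *: u) f = c *: u f. Proof. by []. Qed.

Definition ord (i : nat) u : Prop := diff_order i u.

Fact mulop_subproof a : (fun f => a * f) \in @diffop_pred K O.
Proof.
apply/asboolP; split=> [c f g|]; first by rewrite mulrDr -scalerAr.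
by exists 0%N => b f; rewrite mulrCA subrr.
Qed.

Definition mulop a : diffop O := Diffop (mulop_subproof a).

Lemma mulopM a b : mulop (a * b) = mulop a * mulop b.
Proof. by apply: diffop_ext => f; rewrite diffopM /= mulrA. Qed.

Lemma mulop1 : mulop 1 = 1.
Proof. by apply: diffop_ext => f /=; rewrite mul1r. Qed.

Lemma mulop_linear : linear_fun mulop.
Proof.
move=> c a b; apply: diffop_ext => f.
by rewrite diffopD diffopZ /= mulrDl -scalerAl.
Qed.

Lemma mulopC a b : mulop a * mulop b = mulop b * mulop a.
Proof. by rewrite -!mulopM mulrC. Qed.

Definition comm u a : diffop O := u * mulop a - mulop a * u.

Lemma commE u a f : comm u a f = u (a * f) - a * u f.
Proof. by []. Qed.

Lemma comm_linear a : linear_fun (comm ^~ a).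
Proof.
move=> c u v; rewrite /comm mulrDl mulrDr scalerBr.
by rewrite scalerAl scalerAr opprD addrACA.
Qed.

Lemma commM u v a : comm (u * v) a = u * comm v a + comm u a * v.
Proof.
rewrite /comm mulrBr mulrBl !mulrA addrA; congr (_ + _).
by rewrite -!mulrA subrK.
Qed.

Lemma comm_mulop a b : comm (mulop a) b = 0.
Proof. by rewrite /comm mulopC subrr. Qed.

Lemma commC u a b : comm (comm u a) b = comm (comm u b) a.
Proof.
by apply: diffop_ext => f; rewrite !commE (mulrCA b a); ring.
Qed.

Lemma ord_succ i u : ord i.+1 u <-> forall a, ord i (comm u a).
Proof. by []. Qed.

Lemma ord0P u : ord 0 u <-> forall a, comm u a = 0.
Proof.
split=> [u0 a|u0 a f]; first by apply: diffop_ext => f; exact: (u0 a f).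
by have := commE u a f; rewrite u0.
Qed.

Lemma ord_mulop i a : ord i (mulop a).
Proof.
by apply: (@diff_order_le _ _ 0) => // b f /=; rewrite mulrCA subrr.
Qed.

Lemma ord0E u : ord 0 u -> u = mulop (u 1).
Proof.
move=> /ord0P u0; apply: diffop_ext => f; have := commE u f 1.
by rewrite u0 mulr1 => /esym/eqP; rewrite subr_eq0 => /eqP -> /=; rewrite mulrC.
Qed.

Lemma ord_subspace i : lin_subspace [set u | ord i u].
Proof.
split; first by apply: (@diff_order_le _ _ 0) => // b f /=; rewrite mulr0 subr0.
by move=> c u v; exact: diff_orderP.
Qed.

Lemma ordM i j u v : ord i u -> ord j v -> ord (i + j) (u * v).
Proof.
apply: diff_order_comp => f g.
by rewrite addrC -scaleN1r diffop_linear scaleN1r addrC.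
Qed.

Lemma ord_exists u : exists i, ord i u.
Proof. by have [] := diffopP u. Qed.

Lemma ord_le i j u : (i <= j)%N -> ord i u -> ord j u.
Proof. exact: diff_order_le. Qed.

Fact derop_subproof d : is_deriv d -> d \in @diffop_pred K O.
Proof.
move=> [dl dM]; apply/asboolP; split=> //; exists 1%N => a b f /=.
by rewrite !dM mulrDr [a * (b * _)]mulrCA !addrK (mulrCA b) subrr.
Qed.

Definition derop d (derd : is_deriv d) : diffop O := Diffop (derop_subproof derd).

Lemma comm_derop d (derd : is_deriv d) a : comm (derop derd) a = mulop (d a).
Proof. by apply: diffop_ext => f; rewrite commE /= derd.2 addrK. Qed.

Lemma ord_derop d (derd : is_deriv d) : ord 1 (derop derd).
Proof. by apply/ord_succ => a; rewrite comm_derop; exact: ord_mulop. Qed.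

(* Etale coordinates y on the open set chD <> 0, with chd i = chD * d/dy_i. *)
Record chart (n : nat) := Chart {
  chD : O;
  chy : 'I_n -> O;
  chd : 'I_n -> O -> O;
  chD_neq0 : chD <> 0;
  chd_deriv : forall i, is_deriv (chd i);
  chdy : forall i j, chd i (chy j) = chD *+ (i == j);
  ch_uniq : forall e : O -> O, is_deriv e -> (forall j, e (chy j) = 0) ->
    forall f, e f = 0
}.

Section Chart.
Variables (n : nat) (C : chart n).
Local Notation D := (chD C).
Local Notation y := (chy C).
Local Notation dd i := (derop (chd_deriv C i)).

(** By induction on the order, each [comm u b] is the multiplication by some e(b). Then e is a
    derivation that kills the coordinates, hence zero by [ch_uniq]. *)
Lemma ord0_chart u : (forall l, comm u (y l) = 0) -> ord 0 u.
Proof.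
have [j] := ord_exists u; elim: j u => [//|j IH] u /ord_succ uj uy.
apply/ord0P => a; pose e b := comm u b 1.
have commu b : comm u b = mulop (e b).
  by apply/ord0E/IH => // l; rewrite commC uy /comm mul0r mulr0 subrr.
have eM b c : e (b * c) = e b * c + b * e c.
  have := congr1 (fun v : diffop O => v c) (commu b); rewrite commE /= => <-.
  by rewrite /e !commE !mulr1 mulrBr mulrA addrA subrK.
have derive : is_deriv e.
  split=> // c f g; rewrite /e !commE !mulr1 mulrDl -scalerAl diffop_linear.
  by rewrite scalerBr opprD addrACA.
rewrite commu (@ch_uniq _ C e derive); last by move=> l; rewrite /e uy.
exact: linear_fun0 mulop_linear.
Qed.

(** Commutators with functions can be exchanged ([commC]), which reduces the claim to
    [ord0_chart]. *)
Lemma ordS_chart i u : (forall l, ord i (comm u (y l))) -> ord i.+1 u.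
Proof.
elim: i u => [|i IH] u uy; apply/ord_succ => a.
  by apply: ord0_chart => l; rewrite commC; exact: (proj1 (ord0P _) (uy l)).
by apply: IH => l; rewrite commC; exact: (proj1 (ord_succ _ _) (uy l)).
Qed.

Lemma comm_sum (I : Type) (r : seq I) (f : I -> diffop O) a :
  comm (\sum_(i <- r) f i) a = \sum_(i <- r) comm (f i) a.
Proof.
elim/big_rec2: _ => [|i u v _ <-]; first exact: linear_fun0 (comm_linear a).
by have := comm_linear a 1 (f i) v; rewrite !scale1r.
Qed.

Lemma commB u v a : comm (u - v) a = comm u a - comm v a.
Proof. by rewrite addrC -scaleN1r comm_linear scaleN1r addrC. Qed.

Lemma commZ c u a : comm (c *: u) a = c *: comm u a.
Proof.
have := comm_linear a c u 0; rewrite !addr0 => ->.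
by rewrite (linear_fun0 (comm_linear a)) addr0.
Qed.

(** On symbols, [comm u (y j)] is the derivative by the cotangent coordinate xi_j and [dd j] is D
    xi_j, so this is D times (c minus the Euler operator). *)
Definition euler c u : diffop O :=
  c *: (mulop D * u) - \sum_j comm u (y j) * dd j.

Lemma comm_euler c u l :
  comm (euler c u) (y l) = euler c (comm u (y l)) - comm u (y l) * mulop D.
Proof.
rewrite /euler commB commZ commM comm_mulop mul0r addr0 -addrA -opprD.
congr (_ - _); rewrite comm_sum.
under eq_bigr => j _ do rewrite commM comm_derop chdy commC.
rewrite big_split /= addrC; congr (_ + _).
rewrite (bigD1 l) //= eqxx mulr1n big1 ?addr0 // => j /negPf ->.
by rewrite mulr0n (linear_fun0 mulop_linear) mulr0.
Qed.

(* The symbol of [euler i.+1 u] vanishes by Euler's identity. *)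
Lemma ord_euler i u : ord i.+1 u -> ord i (euler i.+1%:R u).
Proof.
elim: i u => [|i IH] u /ord_succ uy.
  apply: ord0_chart => l; rewrite comm_euler /euler scale1r.
  rewrite [\sum_j _]big1 => [|j _]; last first.
    by rewrite (proj1 (ord0P _) (uy (y l))) mul0r.
  rewrite subr0; have := proj1 (ord0P _) (uy (y l)) D.
  by rewrite /comm => /eqP; rewrite subr_eq0 => /eqP ->; rewrite subrr.
apply: ordS_chart => l; rewrite comm_euler.
(* Moving D to the other side of [comm u (y l)] costs a further commutator and lowers the Euler
   coefficient by one, as the smaller order of [comm u (y l)] requires. *)
have -> : euler i.+2%:R (comm u (y l)) - comm u (y l) * mulop D =
    euler i.+1%:R (comm u (y l)) - comm (comm u (y l)) D.
  rewrite /euler -[i.+2]addn1 natrD scalerDl scale1r /comm !opprB.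
  by rewrite -!addrA; congr (_ + _); rewrite addrCA; congr (_ + _); rewrite addrC.
apply: (subspaceB (ord_subspace i)); first exact/IH/uy.
by move/ord_succ: (uy (y l)); exact.
Qed.

(** [comm u (y l)] vanishes on monomials of degree less by one, hence is zero by induction. So u is
    the multiplication by u(1) = 0. *)
Lemma ord_eq0 i u : ord i u ->
  (forall m : mpoly.multinom n, (mpoly.mdeg m <= i)%N ->
     u (mpoly_eval y (mpoly.mpolyX K m)) = 0) -> u = 0.
Proof.
elim: i u => [|i IH] u ui um.
  rewrite (ord0E ui); have := um mpoly.mnm0.
  rewrite mpoly.mdeg0 mpoly.mpolyX0 eval1 => -> //.
  exact: linear_fun0 mulop_linear.
have uy l : comm u (y l) = 0.
  apply: IH => [|m mi]; first by move/ord_succ: ui; exact.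
  rewrite commE um ?(leqW mi) // mulr0 subr0.
  have := um (mpoly.mnm_add m (mpoly.mnm1 l)).
  rewrite mpoly.mdegD mpoly.mdeg1 addn1 ltnS => /(_ mi).
  by rewrite mpoly.mpolyXD evalM evalX mulrC.
have u0 : ord 0 u by exact: ord0_chart.
rewrite (ord0E u0); have := um mpoly.mnm0.
rewrite mpoly.mdeg0 mpoly.mpolyX0 eval1 => -> //.
exact: linear_fun0 mulop_linear.
Qed.

End Chart.

(** * Generators of the ring of differential operators *)

Section Generation.
Variables (n : nat) (T : finType) (C : T -> chart n) (h : T -> O).
Hypothesis partition_unity : \sum_t h t * chD (C t) = 1.
Variable (x : seq O).
Hypothesis xO : alg_generates x.

Definition diffop_gens : seq (diffop O) :=
  map mulop x ++ codom (fun s : T * 'I_n => derop (chd_deriv (C s.1) s.2)).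

Lemma diffop_generates : alg_generates diffop_gens.
Proof.
rewrite /alg_generates; set S := \bigcup_i _.
have subS : lin_subspace S.
  split; first by exists 0%N => //; exact: (filt_subspace _ _).1.
  move=> c u v [i _ iu] [j _ jv]; exists (maxn i j) => //.
  apply: (filt_subspace _ _).2; first exact: filt_le (leq_maxl _ _) iu.
  exact: filt_le (leq_maxr _ _) jv.
have SM u v : S u -> S v -> S (u * v).
  by move=> [i _ iu] [j _ jv]; exists (i + j)%N => //; exact: filtM.
have Sg u : u \in diffop_gens -> S u.
  by move=> ug; exists 1%N => //; exact: filt_gen.
have Sm f : S (mulop f).
  have : [set: O] f by []; rewrite -xO => -[i _]; move: f.
  apply: (@filt_ind _ _ _ [set f | S (mulop f)]).
  - exact: subspace_preim mulop_linear subS.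
  - by rewrite /mkset mulop1; exists 0%N => //; exact: filt1.
  - move=> f g fx Sg'; rewrite /mkset mulopM; apply: SM => //; apply: Sg.
    by rewrite mem_cat map_f.
have Sd t j : S (derop (chd_deriv (C t) j)).
  by apply: Sg; rewrite mem_cat; apply/orP; right; apply/codomP; exists (t, j).
apply/seteqP; split=> // u _; have [i] := ord_exists u.
elim: i u => [|i IH] u ui; first by rewrite (ord0E ui).
have Su t : S (mulop (chD (C t)) * u).
  have i0 : i.+1%:R != 0 :> K by rewrite (proj1 (pcharf0P _) char0).
  rewrite -[_ * u]scale1r -(mulVf i0) -scalerA; apply: subspaceZ => //.
  rewrite -[X in S X](subrK
    (\sum_j comm u (chy (C t) j) * derop (chd_deriv (C t) j))).
  apply: subspaceD => //; first exact/IH/ord_euler.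
  apply: subspace_sum => // j _; apply: SM => //; apply: IH.
  by move/ord_succ: ui; exact.
rewrite -[u]mul1r -mulop1 -partition_unity.
have -> : mulop (\sum_t h t * chD (C t)) =
    \sum_t mulop (h t) * mulop (chD (C t)).
  have := @linear_fun_sum _ _ _ _ T (index_enum T) xpredT (fun=> 1)
    (fun t => h t * chD (C t)) mulop_linear.
  under eq_bigr do rewrite scale1r; move=> ->.
  by apply: eq_bigr => t _; rewrite scale1r mulopM.
rewrite mulr_suml; apply: subspace_sum => // t _; rewrite -mulrA.
exact: SM.
Qed.

End Generation.
End DifferentialOperators.

(** * Upper bound for differential operators *)

Section UpperBound.
Set Implicit Arguments.
Unset Strict Implicit.
Local Open Scope classical_set_scope.
Variables (K : fieldType) (O : comAlgType K) (x : seq O).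
Implicit Types (u v : diffop O) (a b f : O).
Hypothesis xO : alg_generates x.

(** For a generator a, u(a b) = [u, a](b) + a u(b). The commutators with the finitely many
    generators shift degrees boundedly by induction on the order, and the second term has the same
    shift as u(b). *)
Lemma ord_filt i u : ord i u -> exists c, forall j f,
  alg_filtration x j f -> alg_filtration x (j + c) (u f).
Proof.
elim: i u => [|i IH] u ui.
  have [c hc] := alg_generates_filt (fun _ : unit => u 1) xO.
  exists c => j f xf; rewrite (ord0E ui) /= addnC; apply: filtM => //.
  exact: (hc tt).
have /choice[g hg] (s : 'I_(size x)) := IH _ (proj1 (ord_succ _ _) ui x`_s).
have [c hc] := alg_generates_filt (fun _ : unit => u 1) xO.
exists (c + \max_s g s)%N; elim=> [|j IHj] f.
  move: f; apply: lin_span_min => [|_ ->].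
    exact: subspace_preim (diffop_linear u) (filt_subspace _ _).
  by rewrite /mkset add0n; apply: filt_le (hc tt); rewrite leq_addr.
move: f; apply: lin_span_min => [|_ [a [b [xa xb ->]]]].
  exact: subspace_preim (diffop_linear u) (filt_subspace _ _).
move: a xa; apply: (@lin_span_min _ _
  [set a | alg_filtration x (j.+1 + (c + \max_s g s)) (u (a * b))]).
  apply: subspace_preim (filt_subspace _ _) => d v w.
  by rewrite mulrDl -scalerAl diffop_linear.
move=> a [->|ax].
  by rewrite /mkset mul1r; apply: filt_le (IHj _ xb); rewrite addSn.
have {}ax : a \in x by [].
have ai : (index a x < size x)%N by rewrite index_mem.
have xc := hg (Ordinal ai) j b xb; rewrite commE /= nth_index // in xc.
rewrite /mkset -[u _](subrK (a * u b)) addSn.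
apply: subspaceD (filt_subspace _ _) _ _.
  apply: filt_le xc; apply: leq_trans (leqnSn _).
  by rewrite leq_add2l (leq_trans _ (leq_addl _ _)) // leq_bigmax.
by rewrite -add1n; apply: filtM; [exact: filt_gen | exact: IHj].
Qed.

Lemma diffop_filt (d : seq (diffop O)) : exists c, forall i u,
  alg_filtration d i u -> ord (c * i) u /\
  forall j f, alg_filtration x j f -> alg_filtration x (j + c * i) (u f).
Proof.
have /choice[c hc] (s : 'I_(size d)) : exists c, ord c (d`_s) /\
    forall j f, alg_filtration x j f -> alg_filtration x (j + c) (d`_s f).
  have [i ui] := ord_exists d`_s; have [c hc] := ord_filt ui.
  exists (maxn i c); split; first exact: ord_le (leq_maxl _ _) ui.
  by move=> j f /hc; apply: filt_le; rewrite leq_add2l leq_maxr.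
(* [P k] bounds the order and the degree shift at once and is multiplicative, so one constant for
   the generators gives a linear bound for all products. *)
pose P k := [set u : diffop O | ord k u /\
  forall j f, alg_filtration x j f -> alg_filtration x (j + k) (u f)].
have subP k : lin_subspace (P k).
  split; first split.
  - exact: (@ord_subspace _ O k).1.
  - by move=> j f _; rewrite diffop0; exact: (filt_subspace _ _).1.
  - move=> a u v [ou hu] [ov hv]; split; first exact: (@ord_subspace _ O k).2.
    move=> j f xf; rewrite diffopD diffopZ; apply: (filt_subspace _ _).2.
      exact: hu.
    exact: hv.
have P_le k l u : (k <= l)%N -> P k u -> P l u.
  move=> kl [ou hu]; split; first exact: ord_le ou.
  by move=> j f /hu; apply: filt_le; rewrite leq_add2l.
have PM k l u v : P k u -> P l v -> P (k + l)%N (u * v).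
  move=> [ou hu] [ov hv]; split; first exact: ordM.
  by move=> j f /hv/hu; rewrite -addnA (addnC l).
have P1 k : P k 1.
  split; last by move=> j f xf; apply: filt_le xf; rewrite leq_addr.
  by rewrite -mulop1; exact: ord_mulop.
suff H i : alg_filtration d i `<=` P ((\max_s c s) * i)%N.
  by exists (\max_s c s)%N => i u du; exact: (H i u du).
elim: i => [|i IH].
  by apply: lin_span_min => [|_ ->]; [exact: subP | exact: P1].
apply: lin_span_min => [|_ [v [w [dv dw ->]]]]; first exact: subP.
rewrite mulnS; apply: (PM) (IH _ dw).
suff : lin_span (1 |` [set` d]) `<=` P (\max_s c s) by exact.
apply: lin_span_min => [|v' [->|vd]]; [exact: subP | exact: P1 |].
have {}vd : v' \in d by [].
have vi : (index v' d < size d)%N by rewrite index_mem.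
have := hc (Ordinal vi); rewrite [d`_ _]nth_index //; apply: P_le.
exact: leq_bigmax.
Qed.

Variables (n : nat) (C : chart O n) (B : nat).
Hypothesis growthO : forall i, dim_le (alg_filtration x i) (B * i.+1 ^ n).

Lemma diffop_dim_le (d : seq (diffop O)) : exists B', forall i,
  dim_le (alg_filtration d i) (B' * i.+1 ^ (2 * n)).
Proof.
have [c hc] := diffop_filt d.
have [e he] := alg_generates_filt (chy C) xO.
(* a i bounds the degree of u(y^m): each of n coordinates has degree e and exponent at most c i, and
   u adds c i. *)
pose a := (n * (e * c) + c)%N.
exists (c.+1 ^ n * (B * a.+1 ^ n))%N => i.
have expS k : ((k * i).+1 ^ n <= k.+1 ^ n * i.+1 ^ n)%N.
  have [->|n0] := posnP n; first by rewrite !expn0.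
  by rewrite -expnMn leq_exp2r // mulSn mulnS addSn ltnS addnA leq_addl.
pose T (m : {ffun 'I_n -> 'I_(c * i).+1}) (u : diffop O) : O :=
  u (\prod_j chy C j ^+ m j).
have xm (m : {ffun 'I_n -> 'I_(c * i).+1}) :
    alg_filtration x (n * (e * c) * i) (\prod_j chy C j ^+ m j).
  have -> : (n * (e * c) * i = \sum_(j < n) e * (c * i))%N.
    by rewrite sum_nat_const card_ord !mulnA.
  elim/big_rec2: _ => [|j k f _ xf]; first exact: filt1.
  apply: filtM xf; apply: filt_le (filtX (m j) (he j)).
  by rewrite leq_mul2l -ltnS ltn_ord orbT.
have dimd : dim_le (alg_filtration d i)
    (#|{ffun 'I_n -> 'I_(c * i).+1}| * (B * (a * i).+1 ^ n)).
  apply: (dim_le_joint (T := T) _ _ _ (@growthO (a * i)%N)).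
  - exact: filt_subspace.
  - exact: filt_subspace.
  - by move=> m k u v; rewrite /T diffopD diffopZ.
  - move=> m u /hc[_ hu]; rewrite /T /a mulnDl; exact: hu.
  - move=> u /hc[ou _] um; apply: (ord_eq0 (C := C) ou) => m mi.
    have mj j : (m j < (c * i).+1)%N.
      by rewrite ltnS (leq_trans _ mi) // mpoly.mdegE (bigD1 j) //= leq_addr.
    rewrite evalXm -[RHS](um [ffun j => Ordinal (mj j)]).
    by congr (u _); apply: eq_bigr => j _; rewrite ffunE.
apply: dim_leW dimd => //; rewrite card_ffun !card_ord mul2n -addnn expnD.
rewrite mulnCA; apply: leq_trans (leq_mul (leqnn B) (leq_mul (expS c) (expS a))) _.
by apply/eq_leq; ring.
Qed.

End UpperBound.

(** * Bernstein's argument *)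

Section Bernstein.
Set Implicit Arguments.
Unset Strict Implicit.
Local Open Scope classical_set_scope.
Variables (K : fieldType) (O : comAlgType K).
Hypothesis char0 : [pchar K] =i pred0.
Hypothesis domO : forall a b : O, a * b = 0 -> a = 0 \/ b = 0.
Variables (n : nat) (C : chart O n).
Implicit Types (u v : diffop O) (a b f : O).
Local Notation D := (chD C).
Local Notation y := (chy C).
Local Notation ev := (mpoly_eval y).
Local Notation dd i := (derop (chd_deriv C i)).
Local Notation msize p := (mpoly.mmeasure mpoly.mdeg p).

Lemma chd_eval i p : chd C i (ev p) = D * ev (mpoly.mderiv i p).
Proof.
rewrite deriv_eval; last exact: chd_deriv.
rewrite (bigD1 i) //= chdy eqxx mulr1n mulrC big1 ?addr0 // => j /negPf ji.
by rewrite chdy eq_sym ji mulr0.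
Qed.

Lemma chDX_mul_eq0 k f : D ^+ k * f = 0 -> f = 0.
Proof.
elim: k => [|k IH]; first by rewrite mul1r.
by rewrite exprS -mulrA => /domO[/chD_neq0|].
Qed.

(** Algebraic independence of the coordinates: up to the factor D, the partial derivatives of a
    relation are relations of smaller degree, and those of a nonconstant polynomial do not all
    vanish. *)
Lemma eval_chart_eq0 p : ev p = 0 -> p = 0.
Proof.
have [k] := ubnP (msize p); elim: k p => // k IH p pk ep.
have [p1|p1] := leqP (msize p) 1.
  move: ep; rewrite (mpoly.msize1_polyC p1) evalC => /eqP.
  by rewrite scaler_eq0 oner_eq0 orbF => /eqP ->; rewrite mpoly.mpolyC0.
have [i /eqP[]] := mderiv_neq0 char0 p1; apply: IH.
  apply: leq_ltn_trans (msize_mderiv _ _) _.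
  by move: pk p1; case: (msize p).
apply: (@chDX_mul_eq0 1); rewrite expr1 -chd_eval ep.
exact: der0 (chd_deriv C i).
Qed.

(** As [dd i] is D d/dy_i, the third family consists of the D^2 d/dy_i; the last one supplies the
    correction terms in [dual_op_exists]. *)
Definition chart_gens : seq (diffop O) :=
  mulop D :: codom (fun i => mulop (y i)) ++
  codom (fun i => mulop D * dd i) ++ codom (fun i => mulop (chd C i D)).
Local Notation W := (alg_filtration chart_gens).

Lemma chart_gens_D : W 1 (mulop D).
Proof. by apply: filt_gen; rewrite mem_head. Qed.

Lemma chart_gens_y i : W 1 (mulop (y i)).
Proof. by apply: filt_gen; rewrite in_cons mem_cat codom_f orbT. Qed.

Lemma chart_gens_Dd i : W 1 (mulop D * dd i).
Proof.
apply: filt_gen; rewrite in_cons !mem_cat.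
by rewrite (codom_f (fun i => mulop D * dd i)) !orbT.
Qed.

Lemma chart_gens_dD i : W 1 (mulop (chd C i D)).
Proof.
apply: filt_gen; rewrite in_cons !mem_cat.
by rewrite (codom_f (fun i => mulop (chd C i D))) !orbT.
Qed.

Lemma chart_gens_eval m : W (mpoly.mdeg m) (mulop (ev (mpoly.mpolyX K m))).
Proof.
elim/mnm_ind: m => [|i m IH].
  by rewrite mpoly.mdeg0 mpoly.mpolyX0 eval1 mulop1; exact: filt1.
rewrite mpoly.mdegD mpoly.mdeg1 mpoly.mpolyXD evalM evalX mulopM.
exact: filtM IH (chart_gens_y i).
Qed.

(* On K[y], this operator is D ^ (2 |m|) (d/dy) ^ m. *)
Lemma dual_op_exists m : exists u, [/\ W (mpoly.mdeg m) u, ord (mpoly.mdeg m) u &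
  forall p, u (ev p) = D ^+ (2 * mpoly.mdeg m) * ev (mpoly.mderivm m p)].
Proof.
elim/mnm_ind: m => [|i m [u [Wu ou up]]].
  exists 1; rewrite mpoly.mdeg0; split=> [||p].
  - exact: filt1.
  - by rewrite -mulop1; exact: ord_mulop.
  - by rewrite mpoly.mderivm0m muln0 mul1r.
set k := mpoly.mdeg m in Wu ou up *.
(* Applied to D^(2k) g, the first term yields D^(2k+2) dg/dy_i plus 2k chd_i(D) D^(2k) g, which the
   second term cancels. The extra factor D makes this surplus a multiple of D^(2k) g. *)
pose v : diffop O := mulop D * dd i - (2 * k)%:R *: mulop (chd C i D).
have Wv : W 1 v.
  apply: subspaceB (filt_subspace _ _) (chart_gens_Dd i) _.
  exact: subspaceZ (filt_subspace _ _) (chart_gens_dD i).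
have ov : ord 1 v.
  apply: (subspaceB (@ord_subspace _ O 1)).
    exact: (@ordM _ _ 0 1 _ _ (ord_mulop _ _) (ord_derop _)).
  exact: (subspaceZ _ (@ord_subspace _ O 1) (ord_mulop _ _)).
exists (v * u); rewrite mpoly.mdegD mpoly.mdeg1 -/k addnC; split=> [||p].
- exact: filtM.
- exact: ordM.
rewrite diffopM up addnC mpoly.mderivmDm mpoly.mderivmU1m.
set q := mpoly.mderivm m p.
rewrite /v diffopB diffopZ diffopM /= (chd_deriv C i).2 chd_eval.
have -> : chd C i (D ^+ (2 * k)) = (D ^+ (2 * k).-1 * chd C i D) *+ (2 * k).
  case: (2 * k)%N => [|l]; first exact: der1 (chd_deriv C i).
  by rewrite (derX (chd_deriv C i)).
have E : D * D ^+ (2 * k).-1 *+ (2 * k) = D ^+ (2 * k) *+ (2 * k).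
  by case: (2 * k)%N => [|l]; rewrite ?mulr0n // -exprS.
rewrite scaler_nat mulrDr mulrA mulrnAr mulrA -mulrnAl E.
rewrite mulrnAl -mulrnAl [D * _]mulrA mulnDr [in RHS]exprD expr2.
by ring.
Qed.


(** The exponent e is shared by all inputs, so that the class is a subspace and commutators with the
    coordinates keep e; M bounds the rise of the degree. *)
Definition poly_op (e M : nat) u : Prop := forall p, exists q,
  u (ev p) = D ^+ e * ev q /\ (msize q <= msize p + M)%N.

Lemma poly_op_subspace e M : lin_subspace [set u | poly_op e M u].
Proof.
split=> [p|c u v uP vP p].
  by exists 0; rewrite eval0 mulr0 mpoly.mmeasure0.
have [[q [uq sq]] [r [vr sr]]] := (uP p, vP p).
exists (c *: q + r); split.
  by rewrite diffopD diffopZ uq vr evalD evalZ mulrDr scalerAr.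
apply: leq_trans (mpoly.mmeasureD_le _ _ _) _; rewrite geq_max sr andbT.
exact: leq_trans (mpoly.msizeZ_le _ _) sq.
Qed.

Lemma msize_mulX i (p : mpoly.mpoly n K) :
  (msize (mpoly.mpolyX K (mpoly.mnm1 i) * p) <= (msize p).+1)%N.
Proof.
have [->|p0] := eqVneq p 0; first by rewrite mulr0 mpoly.mmeasure0.
rewrite mpoly.msizeM ?mpoly.msizeX ?mpoly.mdeg1 //.
by rewrite -mpoly.msize_poly_eq0 mpoly.msizeX.
Qed.

Lemma poly_op_comm e M u l : poly_op e M u -> poly_op e M.+1 (comm u (y l)).
Proof.
move=> uP p; have [q [uq sq]] := uP p.
have [r [ur sr]] := uP (mpoly.mpolyX K (mpoly.mnm1 l) * p).
exists (r - mpoly.mpolyX K (mpoly.mnm1 l) * q); split.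
  rewrite commE -[y l](evalX y) -evalM ur uq evalX evalB evalM evalX.
  by rewrite mulrBr mulrCA.
apply: leq_trans (mpoly.mmeasureD_le _ _ _) _; rewrite mpoly.mmeasureN.
rewrite geq_max addnS; apply/andP; split.
  by apply: leq_trans sr _; rewrite -addSn leq_add2r msize_mulX.
by apply: leq_trans (msize_mulX _ _) _; rewrite ltnS.
Qed.

(** * Operators annihilating an element not killed by powers of D *)

Section Annihilator.
Variables (E : lmodType K) (nu : diffop O -> E).
Hypothesis nu_lin : linear_fun nu.
Hypothesis nu_ideal : forall u v, nu v = 0 -> nu (u * v) = 0.
Hypothesis nuD : forall k, nu (mulop (D ^+ k)) <> 0.

(** [nu] stands for u -> u v with v in a module, and [nu_ideal] for the fact that the annihilator of
    v is a left ideal; u is required to kill W_j v. *)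
Definition ann (j : nat) u : Prop := forall z, W j z -> nu (u * z) = 0.

Lemma ann_subspace j : lin_subspace [set u | ann j u].
Proof.
split=> [z _|c u v uP vP z Wz]; first by rewrite mul0r linear_fun0.
by rewrite mulrDl -scalerAl nu_lin uP // vP // scaler0 addr0.
Qed.

Lemma annM j u v : ann j v -> ann j (u * v).
Proof. by move=> vP z Wz; rewrite -mulrA; apply/nu_ideal/vP. Qed.

Lemma ann_le j k u : (j <= k)%N -> ann k u -> ann j u.
Proof. by move=> jk uP z Wz; apply: uP; exact: filt_le Wz. Qed.

Lemma annMr j u v : W 1 v -> ann j.+1 u -> ann j (u * v).
Proof.
by move=> Wv uP z Wz; rewrite -mulrA; apply: uP; rewrite -add1n; exact: filtM.
Qed.

(** Commuting with D^2 d/dy_i replaces p by its derivative at the cost of one unit of j and two more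
    factors D. Once p is a constant, [nuD] forces it to be zero. *)
Lemma ann_poly j k p : ann j (mulop (D ^+ k * ev p)) -> (msize p <= j.+1)%N ->
  p = 0.
Proof.
have base l q : ann 0 (mulop (D ^+ l * ev q)) -> (msize q <= 1)%N -> q = 0.
  move=> /(_ 1 (filt1 _ _)) uq q1; move: uq.
  rewrite (mpoly.msize1_polyC q1) evalC -scalerAr mulr1 mulr1.
  have := mulop_linear (mpoly.mcoeff mpoly.mnm0 q) (D ^+ l) 0.
  rewrite addr0 (linear_fun0 (@mulop_linear _ O)) addr0 => ->.
  have := nu_lin (mpoly.mcoeff mpoly.mnm0 q) (mulop (D ^+ l)) 0.
  rewrite addr0 linear_fun0 // addr0 => -> /eqP.
  rewrite scaler_eq0 => /orP[/eqP ->|/eqP/nuD //]; exact: mpoly.mpolyC0.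
elim: j k p => [|j IH] k p up sp; first exact: base up sp.
have [p1|p1] := leqP (msize p) 1; first exact: base (ann_le (leq0n _) up) p1.
have [i /eqP[]] := mderiv_neq0 char0 p1; apply: (IH k.+2); last first.
  by apply: leq_trans (msize_mderiv _ _) _; rewrite -subn1 leq_subLR.
pose v : diffop O := mulop D * dd i.
set f := D ^+ k * ev p in up.
(* [v, f] is the multiplication by D chd_i(f), which by the Leibniz rule exceeds D^(k+2) dp/dy_i by
   k chd_i(D) f. *)
have -> : mulop (D ^+ k.+2 * ev (mpoly.mderiv i p)) =
    v * mulop f - mulop f * v - mulop (chd C i D *+ k) * mulop f.
  have -> : v * mulop f - mulop f * v = mulop (D * chd C i f).
    rewrite mulopM -(comm_derop (chd_deriv C i)) /comm mulrBr !mulrA.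
    by rewrite -/v (mulopC D).
  rewrite -mulopM -[RHS]addrC -scaleN1r -mulop_linear; congr mulop.
  rewrite /f (chd_deriv C i).2 chd_eval scaleN1r.
  have DE : D * chd C i (D ^+ k) = (D ^+ k * chd C i D) *+ k.
    case: (k) => [|l]; first by rewrite (der1 (chd_deriv C i)) mulr0.
    by rewrite (derX (chd_deriv C i)) mulrnAr mulrA -exprS.
  by rewrite mulrDr [D * (_ * ev p)]mulrA DE !exprS; ring.
apply: (subspaceB (ann_subspace _)); last by apply: annM; exact: ann_le up.
apply: (subspaceB (ann_subspace _)); first by apply: annM; exact: ann_le up.
exact: annMr (chart_gens_Dd i) up.
Qed.

(* Commuting u with the y l decreases the order until u becomes the
   multiplication by some D ^ e * p(y), and commuting with the D d/dy_l then
   decreases the degree of p. Each step costs one unit of the index of ann. *)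
Lemma ann_eq0 r e M u : ord r u -> poly_op e M u -> ann (r + r + M) u -> u = 0.
Proof.
elim: r M u => [|r IH] M u ou up ua.
  have [q [uq sq]] := up 1; have uE := ord0E ou.
  move: uq ua; rewrite eval1 => uq; rewrite uE uq => ua.
  have q0 : q = 0.
    apply: (ann_poly ua).
    by rewrite !add0n -add1n (leq_trans sq) // mpoly.msize1.
  by rewrite q0 eval0 mulr0; exact: linear_fun0 (@mulop_linear _ O).
(* The index r + r + M counts r commutators with coordinates and, since each of them raises M by
   one, a final degree of at most M + r. *)
have uy l : comm u (y l) = 0.
  apply: (IH M.+1); first by move/ord_succ: ou; exact.
    exact: poly_op_comm.
  rewrite addnS; have ua' : ann (r + r + M).+2 u by move: ua; rewrite addnS.
  apply: (subspaceB (ann_subspace _)).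
    exact: annMr (chart_gens_y l) ua'.
  by apply: annM; exact: ann_le ua'.
apply: (IH M u) => //; last by apply: ann_le ua; rewrite leq_add2r leq_add.
by apply: ord_le (leq0n r) _; exact: (ord0_chart uy).
Qed.

End Annihilator.
End Bernstein.

(** * The operators y^a D^(2N) (d/dy)^b *)

Section WeylFamily.
Set Implicit Arguments.
Unset Strict Implicit.
Local Open Scope classical_set_scope.
Variables (K : fieldType) (O : comAlgType K).
Hypothesis char0 : [pchar K] =i pred0.
Hypothesis domO : forall a b : O, a * b = 0 -> a = 0 \/ b = 0.
Variables (n : nat) (C : chart O n).
Implicit Types (u v : diffop O) (a b f : O).
Local Notation D := (chD C).
Local Notation y := (chy C).
Local Notation ev := (mpoly_eval y).
Local Notation msize p := (mpoly.mmeasure mpoly.mdeg p).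
Local Notation W := (alg_filtration (chart_gens C)).
Variable k : nat.
Local Notation box := {ffun 'I_n -> 'I_k.+1}.

Definition box_mnm (t : box) : mpoly.multinom n :=
  mpoly.Multinom [tuple nat_of_ord (t i) | i < n].

Lemma box_mnmE t i : box_mnm t i = t i.
Proof. exact: mpoly.mnmE. Qed.

Lemma box_mnm_inj : injective box_mnm.
Proof.
move=> s t st; apply/ffunP => i; apply/val_inj.
by rewrite /= -!box_mnmE st.
Qed.

Lemma mdeg_box t : (mpoly.mdeg (box_mnm t) <= n * k)%N.
Proof.
rewrite mpoly.mdegE; apply: leq_trans (_ : \sum_(i < n) k <= _)%N.
  by apply: leq_sum => i _; rewrite box_mnmE -ltnS ltn_ord.
by rewrite sum_nat_const card_ord.
Qed.

Local Notation N := (n * k)%N.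

(** These are the properties of the operators y^a D^(2N) (d/dy)^b used in [ann_eq0]. The filtration
    index is N for y^a, and 2 (N - |b|) + |b| <= 2N for the rest. *)
Definition weyl_space : set (diffop O) :=
  [set u | [/\ W (N + N + N) u, ord N u & poly_op C (2 * N) N u]].

Lemma weyl_space_subspace : lin_subspace weyl_space.
Proof.
split=> [|c u v [Wu ou pu] [Wv ov pv]].
  split; [exact: (filt_subspace _ _).1 | exact: (@ord_subspace _ O N).1 |].
  exact: (poly_op_subspace C (2 * N) N).1.
split; [exact: (filt_subspace _ _).2 | exact: (@ord_subspace _ O N).2 |].
exact: (poly_op_subspace C (2 * N) N).2.
Qed.

Lemma msize_mulXm m (p : mpoly.mpoly n K) :
  (msize (mpoly.mpolyX K m * p) <= mpoly.mdeg m + msize p)%N.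
Proof.
have [->|p0] := eqVneq p 0; first by rewrite mulr0 mpoly.mmeasure0.
rewrite mpoly.msizeM ?mpoly.msizeX //.
by rewrite -mpoly.msize_poly_eq0 mpoly.msizeX.
Qed.

Lemma weyl_family : exists G : box * box -> diffop O,
  (forall s, weyl_space (G s)) /\
  (forall s p, G s (ev p) = D ^+ (2 * N) * ev (mpoly.mpolyX K (box_mnm s.1) *
     mpoly.mderivm (box_mnm s.2) p)).
Proof.
have /choice[e he] (t : box) := dual_op_exists C (box_mnm t).
(* The middle factor completes the power D^(2|b|) of the dual operator to the common D^(2N). *)
pose G (s : box * box) := mulop (ev (mpoly.mpolyX K (box_mnm s.1))) *
  mulop (D ^+ (2 * (N - mpoly.mdeg (box_mnm s.2)))) * e s.2.
have Gp s p : G s (ev p) = D ^+ (2 * N) *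
    ev (mpoly.mpolyX K (box_mnm s.1) * mpoly.mderivm (box_mnm s.2) p).
  have [_ _ ep] := he s.2; rewrite /G !diffopM ep /= evalM.
  rewrite [D ^+ _ * (_ * _)]mulrA -exprD -mulnDr subnK ?mdeg_box //.
  by rewrite mulrCA.
exists G; split=> // s; have [We oe _] := he s.2; split.
- apply: (@filt_le _ _ _ (N + 2 * (N - mpoly.mdeg (box_mnm s.2)) +
    mpoly.mdeg (box_mnm s.2))%N).
    rewrite mul2n -addnn -!addnA leq_add2l subnK ?mdeg_box //.
    by rewrite leq_add2r leq_subr.
  apply: filtM We; apply: filtM.
    exact: filt_le (mdeg_box _) (chart_gens_eval _ _).
  set l := (2 * _)%N; elim: l => [|l IH]; first by rewrite expr0 mulop1; exact: filt1.
  by rewrite exprS mulopM -add1n; exact: filtM (chart_gens_D C) IH.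
- apply: ord_le (mdeg_box s.2) _; apply: (@ordM _ _ 0); last exact: oe.
  by apply: (@ordM _ _ 0 0); exact: ord_mulop.
- move=> p; eexists; split; first exact: Gp.
  apply: leq_trans (msize_mulXm _ _) _; rewrite addnC.
  by apply: leq_add (mdeg_box _); exact: msize_mderivm.
Qed.

(** Evaluate at y^b with |b| minimal among the terms that occur. Only terms with this very b
    survive, with the factor b!, which is nonzero in characteristic zero; the monomials y^a then
    separate them. *)
Lemma weyl_family_indep (G : box * box -> diffop O) (c : box * box -> K) :
  (forall s p, G s (ev p) = D ^+ (2 * N) * ev (mpoly.mpolyX K (box_mnm s.1) *
     mpoly.mderivm (box_mnm s.2) p)) ->
  \sum_s c s *: G s = 0 -> forall s, c s = 0.
Proof.
move=> Gp c0 s1; apply: contrapT => /eqP cs1.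
case: (@arg_minnP _ s1 (fun s => c s != 0)
  (fun s : box * box => mpoly.mdeg (box_mnm s.2)) cs1).
move=> s0 cs0 s0min; set b := box_mnm s0.2 in s0min.
have : \sum_s c s *: (mpoly.mpolyX K (box_mnm s.1) *
    mpoly.mderivm (box_mnm s.2) (mpoly.mpolyX K b)) = 0.
  apply: (eval_chart_eq0 char0 domO (C := C)).
  apply: (chDX_mul_eq0 domO (C := C) (k := (2 * N)%N)).
  have c0b : (\sum_s c s *: G s) (ev (mpoly.mpolyX K b)) = 0 by rewrite c0.
  rewrite -[RHS]c0b.
  rewrite eval_sum mulr_sumr.
  elim/big_rec2: _ => [|s f u _ ->]; first by rewrite diffop0.
  by rewrite diffopD diffopZ Gp evalZ scalerAr.
move=> /(congr1 (mpoly.mcoeff (box_mnm s0.1))).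
rewrite mpoly.mcoeff0 raddf_sum /= (bigD1 s0) //= big1 ?addr0 => [|s ss0].
  rewrite mpoly.mcoeffZ mpoly.mderivmX -scalerAr mpoly.mcoeffZ.
  rewrite -[X in mpoly.mnm_sub X _]mpoly.add0m mpoly.addmK mpoly.mpolyX0 mulr1.
  rewrite mpoly.mcoeffX eqxx mulr1 => /eqP; rewrite mulf_eq0 (negPf cs0) /=.
  rewrite (proj1 (pcharf0P _) char0) => p0.
  suff : (0 < \prod_(i < n) (b i) ^_ (box_mnm s0.2 i))%N by rewrite lt0n p0.
  by rewrite prodn_gt0 // => i; rewrite ffactnn fact_gt0.
have [->|cs] := eqVneq (c s) 0; first by rewrite scale0r mpoly.mcoeff0.
rewrite mpoly.mcoeffZ mpoly.mderivmX -scalerAr mpoly.mcoeffZ.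
have [s2|s2] := eqVneq s.2 s0.2.
  rewrite s2 -[X in mpoly.mnm_sub X _]mpoly.add0m mpoly.addmK mpoly.mpolyX0.
  rewrite mulr1 mpoly.mcoeffX; case: eqP; last by rewrite !mulr0.
  move/box_mnm_inj => s1'; case/eqP: ss0.
  by case: (s) (s0) s1' s2 => ? ? [? ?] /= -> ->.
suff [i bi] : exists i, (b i < box_mnm s.2 i)%N.
  by rewrite (bigD1 i) //= ffact_small // mul0n mul0r mulr0.
apply: contrapT => /forallNP sb; case/eqP: s2; apply: box_mnm_inj.
apply/mpoly.mnmP => i; apply/eqP; rewrite eqn_leq.
have sbi j : (box_mnm s.2 j <= b j)%N by rewrite leqNgt; apply/negP/sb.
rewrite sbi /=; have := s0min _ cs; rewrite !mpoly.mdegE.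
rewrite (bigD1 i) //= [X in (_ <= X)%N](bigD1 i) //= => le.
rewrite -(leq_add2r (\sum_(j < n | j != i) box_mnm s.2 j)).
by apply: leq_trans le; rewrite leq_add2l; apply: leq_sum => j _.
Qed.

Lemma weyl_space_dim d : dim_le weyl_space d ->
  (k.+1 ^ n * k.+1 ^ n <= d)%N.
Proof.
move=> Ud; have [G [GU Gp]] := weyl_family.
have := indep_card Ud GU (fun c => weyl_family_indep Gp).
by rewrite card_prod card_ffun !card_ord.
Qed.

Lemma chart_gens_dim d : dim_le (W (N + N + N)) d ->
  (k.+1 ^ n * k.+1 ^ n <= d)%N.
Proof. by move=> Wd; apply: weyl_space_dim; apply: dim_leW Wd => // u []. Qed.

(* Let w = W (N + N + N). An element u of weyl_space with u w in the kernel of nu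
   is zero, so that weyl_space embeds in Hom (nu w, nu (w w)). *)
Lemma bernstein_dim (E : lmodType K) (nu : diffop O -> E) d1 d2 :
  linear_fun nu -> (forall u v, nu v = 0 -> nu (u * v) = 0) ->
  (forall j, nu (mulop (D ^+ j)) <> 0) ->
  dim_le (nu @` W (N + N + N)) d1 ->
  dim_le (nu @` W (N + N + N + (N + N + N))) d2 ->
  (k.+1 ^ n * k.+1 ^ n <= d1 * d2)%N.
Proof.
move=> nu_lin nu_ideal nuD dim1 dim2.
have sub_im j : lin_subspace (nu @` W j).
  split; first by exists 0; [exact: (filt_subspace _ _).1 | exact: linear_fun0].
  move=> c _ _ [u Wu <-] [v Wv <-]; exists (c *: u + v) => //.
  exact: (filt_subspace _ _).2.
have [e ed [w [_ imw]]] := basis_exists (sub_im _) dim1.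
have /choice[z hz] i : exists z, W (N + N + N) z /\ nu z = w i.
  have : (nu @` W (N + N + N)) (w i).
    by rewrite imw; apply: sub_lin_span; exists i.
  by move=> [u Wu <-]; exists u.
apply: leq_trans (leq_mul ed (leqnn d2)).
apply: weyl_space_dim; rewrite -[e]card_ord.
apply: (dim_le_joint (T := fun i u => nu (u * z i)) _ _ _ dim2).
- exact: weyl_space_subspace.
- exact: sub_im.
- by move=> i c u v; rewrite mulrDl -scalerAl nu_lin.
- move=> i u [Wu _ _]; exists (u * z i) => //.
  by apply: filtM => //; exact: (hz i).1.
(* With order N and degree rise N, [ann_eq0] requires annihilation on the index N + N + N, which is
   the space spanned by the [z i] modulo the kernel of [nu]. *)
move=> u [Wu ou pu] uz.
apply: (ann_eq0 char0 nu_lin nu_ideal nuD ou pu) => v Wv.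
have : (nu @` W (N + N + N)) (nu v) by exists v.
rewrite imw => /lin_span_range[c vc].
have vz : nu (v - \sum_i c i *: z i) = 0.
  rewrite addrC -scaleN1r nu_lin linear_fun_sum // vc scaleN1r.
  by under eq_bigr => i _ do rewrite (hz i).2; rewrite addNr.
rewrite -[v](subrK (\sum_i c i *: z i)) mulrDr -[_ * (_ - _)]scale1r nu_lin.
rewrite (nu_ideal _ _ vz) scaler0 add0r mulr_sumr.
under eq_bigr => i _ do rewrite -scalerAr.
by rewrite linear_fun_sum // big1 // => i _; rewrite uz scaler0.
Qed.

End WeylFamily.

(** * Points of a ring in a field *)

Section FieldOfPoints.
Set Implicit Arguments.
Unset Strict Implicit.
Local Open Scope classical_set_scope.

Section FieldOf.
Variables (S : comNzRingType).
Hypothesis inv_exists : forall x : S, x != 0 -> exists y, y * x = 1.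

(* The dummy let makes the hypothesis a parameter of the type. *)
Definition field_of : Type := let _ := inv_exists in S.
HB.instance Definition _ := GRing.ComNzRing.on field_of.

Let invP (x : field_of) : exists y : field_of, if x == 0 then y = 0 else y * x = 1.
Proof.
case: (eqVneq x 0) => [_|x0]; first by exists 0.
exact: inv_exists.
Qed.

Let inv (x : field_of) : field_of := projT1 (cid (invP x)).

Let invE (x : field_of) : if x == 0 then inv x = 0 else inv x * x = 1.
Proof. exact: projT2 (cid (invP x)). Qed.

Let mulVx (x : field_of) : x != 0 -> inv x * x = 1.
Proof. by move=> /negPf x0; have := invE x; rewrite x0. Qed.

Let inv0 : inv 0 = 0.
Proof. by have := invE 0; rewrite eqxx. Qed.

HB.instance Definition _ := GRing.ComNzRing_isField.Build field_of mulVx inv0.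
End FieldOf.

Section DomainOf.
Variables (S : comNzRingType).
Hypothesis domS : forall a b : S, a * b = 0 -> a = 0 \/ b = 0.

Definition domain_of : Type := let _ := domS in S.
HB.instance Definition _ := GRing.ComNzRing.on domain_of.

Let unit : pred domain_of := fun x => `[< exists y, y * x = 1 >].
Let invP (x : domain_of) : exists y, if unit x then y * x = 1 else y = x.
Proof. by case: (boolP (unit x)) => [/asboolP|_] //; exists x. Qed.
Let inv (x : domain_of) : domain_of := projT1 (cid (invP x)).
Let invE (x : domain_of) : if unit x then inv x * x = 1 else inv x = x.
Proof. exact: projT2 (cid (invP x)). Qed.

Let mulVx : {in unit, left_inverse 1 inv *%R}.
Proof.
move=> x xu; have := invE x; have -> // : unit x = true by exact: xu.
Qed.
Let unitPl (x y : domain_of) : y * x = 1 -> x \in unit.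
Proof. by move=> yx; apply/asboolP; exists y. Qed.
Let inv_out : {in [predC unit], inv =1 id}.
Proof.
move=> x xu; have := invE x; have -> // : unit x = false.
by apply/negP; exact: negP xu.
Qed.

HB.instance Definition _ :=
  GRing.ComNzRing_hasMulInverse.Build domain_of mulVx unitPl inv_out.

Let idom : GRing.integral_domain_axiom domain_of.
Proof. by move=> x y /domS[] ->; rewrite eqxx ?orbT. Qed.

HB.instance Definition _ := GRing.ComUnitRing_isIntegral.Build domain_of idom.
End DomainOf.

Section DomainFraction.
Variables (S : comNzRingType).
Hypothesis domS : forall a b : S, a * b = 0 -> a = 0 \/ b = 0.
Local Notation dS := (domain_of domS).

Definition domain_frac (x : S) : {fraction dS} := tofrac (x : dS).

Let domain_frac_zmod : zmod_morphism domain_frac.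
Proof. exact: (@tofracB dS). Qed.
Let domain_frac_monoid : monoid_morphism domain_frac.
Proof. by split; [exact: (@tofrac1 dS) | exact: (@tofracM dS)]. Qed.

HB.instance Definition _ := GRing.isZmodMorphism.Build S {fraction dS}
  domain_frac domain_frac_zmod.
HB.instance Definition _ := GRing.isMonoidMorphism.Build S {fraction dS}
  domain_frac domain_frac_monoid.

(** The generic point: ranks and identities over a domain are tested in its fraction field. *)
Lemma domain_field :
  exists (L : fieldType) (f : {rmorphism S -> L}), forall x, f x = 0 -> x = 0.
Proof.
exists {fraction dS}, domain_frac => x /eqP.
by rewrite /= /domain_frac tofrac_eq0 => /eqP.
Qed.
End DomainFraction.

Definition is_ideal (S : comNzRingType) (J : set S) : Prop :=
  [/\ J 0, forall x y, J x -> J y -> J (x + y) & forall a x, J x -> J (a * x)].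

Lemma maximal_ideal (S : comNzRingType) (J : set S) : is_ideal J -> ~ J 1 ->
  exists M : set S, [/\ is_ideal M, ~ M 1, J `<=` M &
    forall x, ~ M x -> exists a, M (1 - a * x)].
Proof.
move=> idJ J1.
pose P (M : set S) := M = set0 \/ [/\ is_ideal M, ~ M 1 & J `<=` M].
have [F FP Ftot|M [PM Mmax]] := @Zorn_bigcup S P.
  have [[X FX X0]|Fn0] := pselect (exists2 X, F X & X !=set0); last first.
    left; rewrite -subset0 => x [X FX Xx]; apply: Fn0; exists X => //.
    by exists x.
  have PX Y y : F Y -> Y y -> [/\ is_ideal Y, ~ Y 1 & J `<=` Y].
    by move=> /FP[->|].
  have [x0 Xx0] := X0; have [[X00 _ _] _ JX] := PX _ _ FX Xx0.
  right; split; last by move=> x /JX Xx; exists X.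
    split; first by exists X.
      move=> x y [Y FY Yx] [Z FZ Zy].
      have [YZ|ZY] := Ftot _ _ FY FZ.
        by exists Z => //; have [[_ + _] _ _] := PX _ _ FZ Zy; apply => //; exact: YZ.
      by exists Y => //; have [[_ + _] _ _] := PX _ _ FY Yx; apply => //; exact: ZY.
    move=> a x [Y FY Yx]; exists Y => //.
    by have [[_ _ +] _ _] := PX _ _ FY Yx; apply.
  by move=> [Y FY Y1]; have [_ /(_ Y1)] := PX _ _ FY Y1.
have {PM}[idM M1 JM] : [/\ is_ideal M, ~ M 1 & J `<=` M].
  case: PM => // M0; exfalso; apply: (Mmax J); last by right; split.
  by rewrite M0; split=> // /(_ 0); apply; case: idJ.
exists M; split=> // x Mx; apply: contrapT => nx.
have [M0 MD MM] := idM.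
pose M' := [set z | exists m a, M m /\ z = m + a * x].
have MM' : M `<=` M' by move=> m Mm; exists m, 0; rewrite mul0r addr0.
apply: (Mmax M').
  split=> // /(_ x) M'x; apply/Mx/M'x.
  by exists 0, 1; rewrite add0r mul1r.
right; split.
- split; first exact: MM'.
    move=> _ _ [m [a [Mm ->]]] [l [b [Ml ->]]]; exists (m + l), (a + b).
    by split; [exact: MD | rewrite mulrDl addrACA].
  move=> c _ [m [a [Mm ->]]]; exists (c * m), (c * a).
  by split; [exact: MM | rewrite mulrDr mulrA].
- by move=> [m [a [Mm e1]]]; apply: nx; exists a; rewrite e1 addrK.
- by move=> y /JM /MM'.
Qed.

Section ResidueField.
Local Open Scope quotient_scope.
Variables (S : comNzRingType) (M : set S).
Hypothesis idM : is_ideal M.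
Hypothesis M1 : ~ M 1.

Definition ideal_pred : {pred S} := let _ := (idM, M1) in fun x => `[< M x >].

Let ideal_pred_closed : idealr_closed ideal_pred.
Proof.
have [M0 MD MM] := idM; split=> [||a x y].
- exact/asboolP.
- by apply/negP => /asboolP.
- by move=> /asboolP Mx /asboolP My; apply/asboolP/MD => //; exact: MM.
Qed.

HB.instance Definition _ := isIdealr.Build S ideal_pred ideal_pred_closed.

Local Notation Q := {ideal_quot ideal_pred}.

Lemma pi_eq0 (x : S) : \pi_Q x = 0 <-> M x.
Proof.
have := Quotient.idealrBE ideal_pred x 0; rewrite subr0 => xE.
split=> [px|Mx]; last by apply/eqP; move: xE; rewrite raddf0 => <-; apply/asboolP.
by apply/asboolP; rewrite -[asbool _]/(x \in ideal_pred) xE px raddf0.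
Qed.

Hypothesis maxM : forall x, ~ M x -> exists a, M (1 - a * x).

Lemma residue_inv (x : Q) : x != 0 -> exists y : Q, y * x = 1.
Proof.
rewrite -[x]reprK => /eqP xn0.
have [|a /pi_eq0 Ma] := maxM (x := repr x); first by move=> /pi_eq0.
exists (\pi_Q a); rewrite -rmorphM.
by move/eqP: Ma; rewrite rmorphB rmorph1 subr_eq0 eq_sym => /eqP.
Qed.

Local Notation k := (field_of residue_inv).

Definition residue (x : S) : k := \pi_Q x.

Let residue_zmod : zmod_morphism residue.
Proof. by move=> x y; exact: (rmorphB \pi_Q). Qed.
Let residue_monoid : monoid_morphism residue.
Proof. by split=> [|x y]; [exact: (rmorph1 \pi_Q) | exact: (rmorphM \pi_Q)]. Qed.

HB.instance Definition _ := GRing.isZmodMorphism.Build S k residue residue_zmod.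
HB.instance Definition _ :=
  GRing.isMonoidMorphism.Build S k residue residue_monoid.

Lemma residue_field :
  exists (L : fieldType) (f : {rmorphism S -> L}), forall x, M x -> f x = 0.
Proof. by exists k, residue => x Mx; apply/pi_eq0. Qed.

End ResidueField.

(** For a coordinate ring this is a point of the closed subscheme defined by [J], with coordinates
    in a possibly larger field, at which smoothness can be applied. *)
Lemma proper_ideal_field (S : comNzRingType) (J : set S) :
  is_ideal J -> ~ J 1 ->
  exists (L : fieldType) (f : {rmorphism S -> L}), forall x, J x -> f x = 0.
Proof.
move=> idJ J1; have [M [idM M1 JM maxM]] := maximal_ideal idJ J1.
have [L [f fM]] := residue_field idM M1 maxM.
by exists L, f => x /JM /fM.
Qed.

End FieldOfPoints.

(** * Charts from minors of the Jacobian matrix *)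

Section Jacobian.
Set Implicit Arguments.
Unset Strict Implicit.
Local Open Scope classical_set_scope.

Lemma rank_minor (L : fieldType) s m r (A : 'M[L]_(s, m)) : \rank A = r ->
  exists t : {ffun 'I_r -> 'I_s} * {ffun 'I_r -> 'I_m},
    \det (mxsub t.1 t.2 A) != 0.
Proof.
move=> <-; pose B := rowsub (maxrankfun A) A.
have Bfull : row_full B^T by rewrite /row_full mxrank_tr -/(row_free B) maxrowsub_free.
exists (maxrankfun A, fullrankfun Bfull) => /=.
have := fullrowsub_unit Bfull; rewrite unitmxE unitfE -det_tr.
by congr (\det _ != 0); apply/matrixP => i j; rewrite !mxE.
Qed.

Lemma row_space_minor (L : fieldType) s m r (A : 'M[L]_(s, m))
    (f : 'I_r -> 'I_s) (g : 'I_r -> 'I_m) :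
  \rank A = r -> \det (mxsub f g A) != 0 -> (A <= rowsub f A)%MS.
Proof.
move=> rA dA; rewrite -(geq_leqif (mxrank_leqif_sup (rowsub_sub f A))) rA.
have rg : \rank (mxsub f g A) = r.
  by apply/eqP; rewrite -/(row_free _) row_free_unit unitmxE unitfE.
rewrite -[X in (X <= _)%N]rg.
have -> : mxsub f g A = rowsub f A *m (\matrix_(j, a) (j == g a)%:R).
  apply/matrixP => i j; rewrite !mxE (bigD1 (g j)) //= !mxE eqxx mulr1.
  by rewrite big1 ?addr0 // => k /negPf kj; rewrite !mxE kj mulr0.
exact: mxrankM_maxl.
Qed.

Lemma det_mxsub_inj (S : comNzRingType) s m r (A : 'M[S]_(s, m))
    (f : 'I_r -> 'I_s) (g : 'I_r -> 'I_m) :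
  \det (mxsub f g A) <> 0 -> injective g.
Proof.
move=> dA i j gij; apply/eqP; apply: contra_notT dA => ij.
rewrite -det_tr; apply: (determinant_alternate ij) => k.
by rewrite !mxE gij.
Qed.

Variables (K : fieldType) (X : affine_scheme K) (n : nat).
Hypothesis X_irreducible : irreducible_variety X.
Hypothesis X_smooth : smooth X n.
Local Notation O := (regfun X).
Local Notation m := (ambient_dim X).
Local Notation s := (nb_equations X).
Local Notation pr := (regfun_proj X).

Definition coordfun (j : 'I_m) : O := pr (mpoly.mpolyX K (mpoly.mnm1 j)).

Lemma projE p : pr p = mpoly_eval coordfun p.
Proof.
elim/mpoly_ring_ind: p => [c|i|p q IHp IHq|p q IHp IHq].
- by rewrite evalC -[mpoly.mpolyC _ _]mulr1 mpoly.mul_mpolyC linearZ rmorph1.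
- by rewrite evalX.
- by rewrite evalD -IHp -IHq rmorphD.
- by rewrite evalM -IHp -IHq rmorphM.
Qed.

Lemma proj_equation i : pr (equations i) = 0.
Proof.
apply/regfun_proj_ker; exists (fun j => (j == i)%:R).
rewrite (bigD1 i) //= eqxx mul1r big1 ?addr0 // => j /negPf ->.
by rewrite mul0r.
Qed.

Definition jac_matrix : 'M[O]_(s, m) :=
  \matrix_(i, j) pr (mpoly.mderiv j (equations i)).

Section Point.
Variables (L : fieldType) (f : {rmorphism O -> L}).

Lemma eval_at_proj p :
  eval_at (f \o in_alg O : {rmorphism K -> L}) (f \o coordfun) p = f (pr p).
Proof.
rewrite /eval_at; elim/mpoly_ring_ind: p => [c|i|p q IHp IHq|p q IHp IHq].
- by rewrite mpoly.mmapC projE evalC.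
- by rewrite mpoly.mmapX mpoly.mmap1U.
- by rewrite mpoly.mmapD IHp IHq !rmorphD.
- by rewrite [LHS](rmorphM (mpoly.mmap _ _)) /= IHp IHq !rmorphM.
Qed.

Lemma jacobian_rank : (\rank (map_mx f jac_matrix) + n = m)%N.
Proof.
rewrite -[RHS](X_smooth (iota := f \o in_alg O) (x := f \o coordfun)).
  by congr (\rank _ + n)%N; apply/matrixP => i j; rewrite !mxE eval_at_proj.
by move=> i; rewrite eval_at_proj proj_equation rmorph0.
Qed.

End Point.

Local Notation r := (m - n)%N.

Lemma rankE (L : fieldType) (f : {rmorphism O -> L}) :
  \rank (map_mx f jac_matrix) = r.
Proof. by rewrite -[in RHS](jacobian_rank f) addnK. Qed.

Lemma dim_le_ambient : (n <= m)%N.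
Proof.
have [L [f _]] := domain_field X_irreducible.
by rewrite -(jacobian_rank f) leq_addl.
Qed.

Local Notation idx := ({ffun 'I_r -> 'I_s} * {ffun 'I_r -> 'I_m})%type.

Definition jminor (t : idx) : O := \det (mxsub t.1 t.2 jac_matrix).

Lemma jminors_unit : exists c : idx -> O, \sum_t c t * jminor t = 1.
Proof.
apply: contrapT => nc.
pose J := [set g : O | exists c : idx -> O, \sum_t c t * jminor t = g].
have idJ : is_ideal J.
  split.
  - by exists (fun=> 0); rewrite big1 // => t _; rewrite mul0r.
  - move=> _ _ [c <-] [d <-]; exists (fun t => c t + d t).
    by rewrite -big_split; apply: eq_bigr => t _; rewrite mulrDl.
  - move=> a _ [c <-]; exists (fun t => a * c t).
    by rewrite mulr_sumr; apply: eq_bigr => t _; rewrite mulrA.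
have [L [f fJ]] := proper_ideal_field idJ nc.
(* At a point where all these minors vanish, the Jacobian matrix would have rank less than m - n. *)
have [t /eqP[]] := rank_minor (rankE f).
rewrite -map_mxsub det_map_mx; apply: fJ.
exists (fun u => (u == t)%:R); rewrite (bigD1 t) //= eqxx mul1r.
by rewrite big1 ?addr0 // => u /negPf ->; rewrite mul0r.
Qed.

(** * Derivations from kernel vectors of the Jacobian matrix *)

Section TangentVector.
Variable v : 'cV[O]_m.
Hypothesis Jv : jac_matrix *m v = 0.

(** The derivation sum_j v_j d/dx_j from K[x] to O(X). It lives on polynomials because the growth of
    O(X) is studied with vectors that respect only some of the relations. *)
Definition tangent_poly (p : mpoly.mpoly m K) : O :=
  \sum_j pr (mpoly.mderiv j p) * v j 0.

Lemma tangent_poly_linear : linear_fun tangent_poly.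
Proof.
move=> c p q; rewrite /tangent_poly scaler_sumr -big_split.
apply: eq_bigr => j _ /=.
by rewrite mpoly.mderivD mpoly.mderivZ linearP mulrDl scalerAl.
Qed.

Lemma tangent_polyM p q :
  tangent_poly (p * q) = tangent_poly p * pr q + pr p * tangent_poly q.
Proof.
rewrite /tangent_poly mulr_suml mulr_sumr -big_split; apply: eq_bigr => j _ /=.
by rewrite mpoly.mderivM rmorphD !rmorphM mulrDl mulrAC mulrA.
Qed.

Lemma tangent_poly_ker p : pr p = 0 -> tangent_poly p = 0.
Proof.
move=> /regfun_proj_ker[c ->].
elim/big_rec: _ => [|i q _ q0]; first exact: linear_fun0 tangent_poly_linear.
rewrite -[_ * _]scale1r tangent_poly_linear q0 addr0 scale1r.
rewrite tangent_polyM proj_equation mulr0 add0r.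
have /matrixP/(_ i 0) := Jv; rewrite [LHS]mxE [RHS]mxE => Jvi.
suff -> : tangent_poly (equations i) = 0 by rewrite mulr0.
by rewrite -Jvi; apply: eq_bigr => j _; rewrite mxE.
Qed.

Lemma tangent_deriv : exists d : O -> O, is_deriv d /\
  forall j, d (coordfun j) = v j 0.
Proof.
have /choice[lift liftP] := @regfun_proj_surj _ X.
have dE p : tangent_poly (lift (pr p)) = tangent_poly p.
  have := tangent_poly_linear (-1) (lift (pr p)) p.
  rewrite tangent_poly_ker; last by rewrite linearP /= liftP scaleN1r addNr.
  by rewrite scaleN1r addrC => /esym/eqP; rewrite subr_eq0 => /eqP.
exists (tangent_poly \o lift); split=> [|j] /=; last first.
  rewrite dE /tangent_poly (bigD1 j) //= big1 => [|i ij].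
    rewrite mpoly.mderivX mpoly.mnm1E eqxx -[X in mpoly.mnm_sub X _]mpoly.add0m.
    by rewrite mpoly.addmK scale1r mpoly.mpolyX0 rmorph1 mul1r addr0.
  by rewrite mpoly.mderivX mpoly.mnm1E eq_sym (negPf ij) scale0r rmorph0 mul0r.
split=> [c a b|a b] /=.
  rewrite -[a in LHS]liftP -[b in LHS]liftP -linearP /= dE.
  exact: tangent_poly_linear.
by rewrite -[a in LHS]liftP -[b in LHS]liftP -rmorphM /= dE tangent_polyM !liftP.
Qed.

End TangentVector.

(** * The chart of a nonzero minor *)

Section MinorChart.
Variable t : idx.
Hypothesis minor_neq0 : jminor t <> 0.
Local Notation rho := t.1.
Local Notation kappa := t.2.
Local Notation N := (mxsub rho kappa jac_matrix).

Lemma kappa_inj : injective kappa.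
Proof. exact: det_mxsub_inj minor_neq0. Qed.

Lemma card_free_coords : #|~: (kappa @: 'I_r)| = n.
Proof.
have := cardsC (kappa @: 'I_r).
rewrite card_imset; last exact: kappa_inj.
rewrite !card_ord => /eqP; rewrite -[X in _ == X](subnK dim_le_ambient) eqn_add2l.
by move/eqP.
Qed.

Definition free_coord (i : 'I_n) : 'I_m :=
  enum_val (cast_ord (esym card_free_coords) i).

Lemma free_coord_inj : injective free_coord.
Proof. by move=> i j /enum_val_inj /cast_ord_inj. Qed.

Lemma free_coordP j : (exists i, j = free_coord i) \/ exists a, j = kappa a.
Proof.
have [/imsetP[a _ ->]|jn] := boolP (j \in (kappa @: 'I_r)).
  by right; exists a.
have jc : j \in ~: (kappa @: 'I_r) by rewrite inE.
left; exists (cast_ord card_free_coords (enum_rank_in jc j)).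
by rewrite /free_coord cast_ordK enum_rankK_in.
Qed.

Lemma free_coord_neq i a : (free_coord i == kappa a) = false.
Proof.
have := enum_valP (cast_ord (esym card_free_coords) i); rewrite inE.
by apply: contraNF => /eqP; rewrite /free_coord => ->; apply: imset_f.
Qed.

Let sel : 'M[O]_(m, r) := \matrix_(j, a) (j == kappa a)%:R.

Lemma rowsub_sel : rowsub rho jac_matrix *m sel = N.
Proof.
apply/matrixP => i j; rewrite !mxE (bigD1 (kappa j)) //= !mxE eqxx mulr1.
by rewrite big1 ?addr0 // => k /negPf kj; rewrite !mxE kj mulr0.
Qed.

(** Over the fraction field the Jacobian matrix has rank r, so the rows of a nonzero r x r minor
    span all its rows. *)
Lemma rowsub_ker (v : 'cV[O]_m) : rowsub rho jac_matrix *m v = 0 ->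
  jac_matrix *m v = 0.
Proof.
move=> Jv; have [L [f f0]] := domain_field X_irreducible.
have : (map_mx f jac_matrix <= rowsub rho (map_mx f jac_matrix))%MS.
  apply: row_space_minor (rankE f) (_ : \det (mxsub _ kappa _) != 0).
  by rewrite -map_mxsub det_map_mx; apply/eqP => /f0 /minor_neq0.
move=> /submxP[B JB]; apply/matrixP => i j; rewrite [RHS]mxE; apply: f0.
have : map_mx f (jac_matrix *m v) = 0.
  by rewrite map_mxM JB -map_mxsub -mulmxA -map_mxM Jv map_mx0 mulmx0.
by move/matrixP/(_ i j); rewrite mxE [RHS]mxE.
Qed.

(** Cramer's rule: the column c of the free coordinate, multiplied by the minor, equals N (adj N c),
    which the pivot coordinates cancel. *)
Definition chart_vector (i : 'I_n) : 'cV[O]_m :=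
  let c := col (free_coord i) (rowsub rho jac_matrix) in
  jminor t *: delta_mx (free_coord i) 0 - sel *m (\adj N *m c).

Lemma chart_vector_ker i : jac_matrix *m chart_vector i = 0.
Proof.
apply: rowsub_ker; rewrite mulmxBr -scalemxAr -colE mulmxA rowsub_sel.
by rewrite mulmxA mul_mx_adj mul_scalar_mx subrr.
Qed.

Lemma chart_vectorE i j : chart_vector i (free_coord j) 0 = jminor t *+ (i == j).
Proof.
rewrite /chart_vector !mxE eqxx andbT (inj_eq free_coord_inj) eq_sym.
rewrite [X in _ - X]big1 ?subr0 => [|a _]; last first.
  by rewrite mxE free_coord_neq mul0r.
by case: eqP => _; rewrite ?mulr1 ?mulr0.
Qed.

(** The values of e on the coordinates form a kernel vector of the Jacobian matrix supported on the
    pivots. So N w = 0, and multiplying by adj N gives w = 0. *)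
Lemma deriv_free_coord (e : O -> O) : is_deriv e ->
  (forall i, e (coordfun (free_coord i)) = 0) -> forall g, e g = 0.
Proof.
move=> dere e0 g; have [p <-] := @regfun_proj_surj _ X g.
pose w := \col_a e (coordfun (kappa a)).
have ecoord j : e (coordfun j) = (sel *m w) j 0.
  rewrite mxE; have [[i ->]|[a ->]] := free_coordP j.
    by rewrite e0 big1 // => a _; rewrite mxE free_coord_neq mul0r.
  rewrite (bigD1 a) //= !mxE eqxx mul1r big1 ?addr0 // => b ba.
  by rewrite mxE (inj_eq kappa_inj) eq_sym (negPf ba) mul0r.
have Jw : jac_matrix *m (sel *m w) = 0.
  apply/matrixP => i j; rewrite mxE [RHS]mxE ord1.
  have : e (pr (equations i)) = 0 by rewrite proj_equation (der0 dere).
  rewrite projE deriv_eval // => e0'; rewrite -[RHS]e0'.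
  by apply: eq_bigr => k _; rewrite mxE -ecoord projE.
have Nw : N *m w = 0.
  rewrite -rowsub_sel -mulmxA; apply/matrixP => i j.
  have /matrixP/(_ (rho i) j) Jwi := Jw; rewrite mxE [RHS]mxE in Jwi.
  by rewrite mxE [RHS]mxE -[RHS]Jwi; apply: eq_bigr => k _; rewrite mxE.
have w0 : w = 0.
  have : \adj N *m (N *m w) = 0 by rewrite Nw mulmx0.
  rewrite mulmxA mul_adj_mx mul_scalar_mx => Dw.
  apply/matrixP => a j; have /matrixP/(_ a j) Dwa := Dw.
  by move: Dwa; rewrite !(mxE _ _ a j) => /X_irreducible[/minor_neq0|].
rewrite projE deriv_eval // big1 // => j _.
by rewrite ecoord w0 mulmx0 mxE mulr0.
Qed.

Lemma minor_chart : exists C : chart O n, chD C = jminor t.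
Proof.
have /choice[d hd] i := tangent_deriv (chart_vector_ker i).
have dy i j : d i (coordfun (free_coord j)) = jminor t *+ (i == j).
  by rewrite (hd i).2 chart_vectorE.
by exists (Chart minor_neq0 (fun i => (hd i).1) dy deriv_free_coord).
Qed.

End MinorChart.

Lemma atlas_exists : exists (T : finType) (C : T -> chart O n) (h : T -> O),
  \sum_t h t * chD (C t) = 1.
Proof.
have [c c1] := jminors_unit.
have [t0 t0n] : exists t, jminor t <> 0.
  apply: contrapT => /forallNP nt; have /eqP := c1; rewrite big1.
    by rewrite eq_sym oner_eq0.
  by move=> t _; have /contrapT -> := nt t; rewrite mulr0.
(* A vanishing minor has no chart; its index receives the chart of [t0] with coefficient zero. *)
have /choice[C hC] t : exists C : chart O n, jminor t <> 0 -> chD C = jminor t.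
  have [->|tn] := pselect (jminor t = 0).
    by have [C _] := minor_chart t0n; exists C.
  by have [C <-] := minor_chart tn; exists C.
exists idx, C, (fun t => if jminor t == 0 then 0 else c t).
rewrite -c1; apply: eq_bigr => t _; case: eqP => [->|/hC ->] //.
by rewrite mul0r mulr0.
Qed.

Lemma coord_generates : alg_generates (codom coordfun).
Proof.
rewrite /alg_generates; set S := \bigcup_i _.
have SD u v : S u -> S v -> S (u + v).
  move=> [i _ iu] [j _ jv]; exists (maxn i j) => //.
  apply: subspaceD (filt_subspace _ _) _ _; first exact: filt_le (leq_maxl _ _) iu.
  exact: filt_le (leq_maxr _ _) jv.
have SM u v : S u -> S v -> S (u * v).
  by move=> [i _ iu] [j _ jv]; exists (i + j)%N => //; exact: filtM.
apply/seteqP; split=> // g _; have [p <-] := @regfun_proj_surj _ X g; rewrite projE.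
elim/mpoly_ring_ind: p => [c|i|p q Sp Sq|p q Sp Sq].
- rewrite evalC; exists 0%N => //.
  by apply: subspaceZ (filt_subspace _ _) _; exact: filt1.
- by rewrite evalX; exists 1%N => //; apply/filt_gen/codom_f.
- by rewrite evalD; exact: SD.
- by rewrite evalM; exact: SM.
Qed.

End Jacobian.

(** * Growth of the coordinate ring *)

Section CoordinateGrowth.
Set Implicit Arguments.
Unset Strict Implicit.
Local Open Scope classical_set_scope.
Variables (K : fieldType) (X : affine_scheme K) (n : nat).
Hypothesis char0 : [pchar K] =i pred0.
Hypothesis X_irreducible : irreducible_variety X.
Hypothesis X_smooth : smooth X n.
Local Notation O := (regfun X).
Local Notation m := (ambient_dim X).
Local Notation s := (nb_equations X).
Local Notation pr := (regfun_proj X).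
Local Notation MP := (mpoly.mpoly m K).
Local Notation var j := (mpoly.mpolyX K (mpoly.mnm1 j)).

Definition nvar (k : nat) : MP := if insub k is Some j then var j else 0.

Lemma nvarE (j : 'I_m) : nvar j = var j.
Proof. by rewrite /nvar valK. Qed.

(* Polynomials in the first k variables, with all exponents at most i. *)
Fixpoint first_vars (k i : nat) : set MP :=
  if k is l.+1 then
    [set p | exists q : {poly MP}, [/\ forall j, first_vars l i q`_j,
                                     (size q <= i.+1)%N & p = q.[nvar l]]]
  else [set p | exists c : K, p = c *: 1].

Lemma first_vars_subspace k i : lin_subspace (first_vars k i).
Proof.
elim: k => [|k IH] /=.
  split=> [|c _ _ [a ->] [b ->]]; first by exists 0; rewrite scale0r.
  by exists (c * a + b); rewrite scalerDl scalerA.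
split=> [|c _ _ [q [qk sq ->]] [r [rk sr ->]]].
  exists 0; rewrite size_poly0 horner0; split=> // j; rewrite coef0.
  exact: IH.1.
exists ((c *: 1 : MP) *: q + r); split=> [j||].
- by rewrite coefD coefZ -scalerAl mul1r; exact: IH.2.
- by rewrite (leq_trans (size_polyD _ _)) // geq_max sr (leq_trans (size_scale_leq _ _)).
- by rewrite hornerD hornerZ -scalerAl mul1r.
Qed.

Lemma first_vars_le k i j p : (i <= j)%N -> first_vars k i p -> first_vars k j p.
Proof.
move=> ij; elim: k p => [//|k IH] p [q [qk sq ->]].
exists q; split=> // [l|]; last exact: leq_trans sq _.
by apply: IH; exact: qk.
Qed.

Lemma first_varsS k i p : first_vars k i p -> first_vars k.+1 i p.
Proof.
move=> pk; exists p%:P; rewrite hornerC; split=> // [j|].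
  by rewrite coefC; case: eqP => // _; exact: (first_vars_subspace k i).1.
by rewrite (leq_trans (size_polyC_leq1 _)).
Qed.

Lemma first_vars1 k i : first_vars k i 1.
Proof.
by elim: k => [|k]; [exists 1; rewrite scale1r | exact: first_varsS].
Qed.

Lemma first_varsM k i j p q : first_vars k i p -> first_vars k j q ->
  first_vars k (i + j) (p * q).
Proof.
elim: k p q => [|k IH] p q.
  by move=> [a ->] [b ->]; exists (a * b); rewrite -scalerAl mul1r scalerA.
move=> [f [fk sf ->]] [g [gk sg ->]]; exists (f * g); split=> [l||].
- rewrite coefM; apply: subspace_sum (first_vars_subspace _ _) _ => t _.
  by apply: IH; [exact: fk | exact: gk].
- apply: leq_trans (size_polyMleq _ _) _; rewrite -subn1 leq_subLR add1n.
  by rewrite -addnS -addSn leq_add.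
- by rewrite hornerM.
Qed.

Lemma first_vars_nvar k : first_vars k.+1 1 (nvar k).
Proof.
exists 'X; rewrite hornerX size_polyX; split=> // j; rewrite coefX.
case: eqP => _; [exact: first_vars1 | exact: (first_vars_subspace _ _).1].
Qed.

Lemma first_vars_var (j : 'I_m) k : (j < k)%N -> first_vars k 1 (var j).
Proof.
elim: k => // k IH; rewrite ltnS leq_eqVlt => /orP[/eqP <-|/IH].
  by rewrite -nvarE; exact: first_vars_nvar.
exact: first_varsS.
Qed.

Definition poly_in (k : nat) (p : MP) : Prop := exists i, first_vars k i p.

Lemma poly_in_all p : poly_in m p.
Proof.
elim/mpoly_ring_ind: p => [c|i|p q [i ip] [j jq]|p q [i ip] [j jq]].
- exists 0%N; rewrite -[mpoly.mpolyC _ _]mulr1 mpoly.mul_mpolyC.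
  apply: subspaceZ (first_vars_subspace _ _) _; exact: first_vars1.
- by exists 1%N; exact: first_vars_var.
- exists (maxn i j); apply: subspaceD (first_vars_subspace _ _) _ _.
    exact: first_vars_le (leq_maxl _ _) ip.
  exact: first_vars_le (leq_maxr _ _) jq.
- by exists (i + j)%N; exact: first_varsM.
Qed.

Lemma poly_in_coefs k (q : {poly MP}) : (forall j, poly_in k q`_j) ->
  exists i, forall j, first_vars k i q`_j.
Proof.
move=> /choice[f hf]; exists (\max_(j < size q) f j)%N => j.
have [js|js] := ltnP j (size q).
  by apply: first_vars_le (hf j); exact: (leq_bigmax (Ordinal js)).
by rewrite nth_default //; exact: (first_vars_subspace _ _).1.
Qed.

Lemma poly_in_subspace k : lin_subspace [set p | poly_in k p].
Proof.
split=> [|c p q [i ip] [j jq]].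
  by exists 0%N; exact: (first_vars_subspace _ _).1.
exists (maxn i j); apply: (first_vars_subspace _ _).2.
  exact: first_vars_le (leq_maxl _ _) ip.
exact: first_vars_le (leq_maxr _ _) jq.
Qed.

Lemma poly_inM k p q : poly_in k p -> poly_in k q -> poly_in k (p * q).
Proof. by move=> [i ip] [j jq]; exists (i + j)%N; exact: first_varsM. Qed.

Lemma mderiv_horner (j : 'I_m) (q : {poly MP}) (x : MP) :
  (forall i, mpoly.mderiv j q`_i = 0) ->
  mpoly.mderiv j q.[x] = q^`().[x] * mpoly.mderiv j x.
Proof.
elim/poly_ind: q => [|q c IH] qj.
  by rewrite deriv0 !horner0 mpoly.mderiv0 mul0r.
have qj' i : mpoly.mderiv j q`_i = 0.
  by have := qj i.+1; rewrite coefD coefMX coefC /= addr0.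
have := qj 0%N; rewrite coefD coefMX coefC /= add0r => cj.
rewrite hornerMXaddC derivD derivM derivX derivC addr0 mulr1 hornerD hornerMX.
by rewrite mpoly.mderivD mpoly.mderivM cj IH // addr0 mulrDl mulrAC.
Qed.

Lemma first_vars_mderiv k i p (j : 'I_m) : (k <= j)%N -> first_vars k i p ->
  mpoly.mderiv j p = 0.
Proof.
elim: k p => [|k IH] p kj /=.
  by move=> [c ->]; rewrite mpoly.mderivZ -(mpoly.mpolyC1 m K) mpoly.mderivC scaler0.
move=> [q [qk sq ->]]; rewrite mderiv_horner => [|l]; last exact: IH (ltnW kj) (qk l).
rewrite /nvar; case: insubP => [l lm lk|_]; last by rewrite mpoly.mderiv0 mulr0.
rewrite mpoly.mderivX mpoly.mnm1E -(inj_eq val_inj) lk ltn_eqF //.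
by rewrite scale0r mulr0.
Qed.

Local Notation tangent := (@tangent_poly K X).

Lemma tangent0 w : tangent w 0 = 0.
Proof. exact: linear_fun0 (tangent_poly_linear w). Qed.

Lemma tangentD w p q : tangent w (p + q) = tangent w p + tangent w q.
Proof. by have := tangent_poly_linear w 1 p q; rewrite !scale1r. Qed.

Lemma tangentB w p q : tangent w (p - q) = tangent w p - tangent w q.
Proof. by rewrite addrC -scaleN1r tangent_poly_linear scaleN1r addrC. Qed.

Lemma tangent_vec (a b : O) (u v : 'cV[O]_m) p :
  tangent (a *: u + b *: v) p = a * tangent u p + b * tangent v p.
Proof.
rewrite /tangent_poly !mulr_sumr -big_split; apply: eq_bigr => j _ /=.
by rewrite !mxE; ring.
Qed.

Lemma tangent_delta (k : 'I_m) p :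
  tangent (delta_mx k 0) p = pr (mpoly.mderiv k p).
Proof.
rewrite /tangent_poly (bigD1 k) //= !mxE !eqxx mulr1 big1 ?addr0 // => j jk.
by rewrite !mxE (negPf jk) mulr0.
Qed.

(* w defines a derivation on the subalgebra generated by the first k
   coordinates, with values in O(X). *)
Definition tangent_to (k : nat) (w : 'cV[O]_m) : Prop :=
  forall p, poly_in k p -> pr p = 0 -> tangent w p = 0.

Lemma tangent_ker_coefs w k (x : MP) (q : {poly MP}) : tangent_to k w ->
  (forall j, poly_in k q`_j) -> map_poly pr q = 0 -> tangent w q.[x] = 0.
Proof.
move=> wk qk /polyP q0; rewrite horner_coef.
elim/big_rec: _ => [|i p _ p0]; first exact: tangent0.
have qi : pr q`_i = 0 by have := q0 i; rewrite coef_map coef0.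
by rewrite tangentD p0 addr0 tangent_polyM wk // qi !mul0r addr0.
Qed.

Lemma pr_horner (q : {poly MP}) x : pr q.[x] = (map_poly pr q).[pr x].
Proof. by rewrite horner_map. Qed.


Lemma poly_inS k p : poly_in k.+1 p -> exists q : {poly MP},
  (forall j, poly_in k q`_j) /\ p = q.[nvar k].
Proof. by move=> [i [q [qk _ ->]]]; exists q; split=> // j; exists i; exact: qk. Qed.

Definition transcendental (k : nat) : Prop := forall q : {poly MP},
  (forall j, poly_in k q`_j) -> pr q.[nvar k] = 0 -> map_poly pr q = 0.

Lemma transcendental_tangent k w : transcendental k -> tangent_to k w ->
  tangent_to k.+1 w.
Proof.
move=> trk wk p /poly_inS[q [qk ->]] /(trk q qk) q0.
exact: tangent_ker_coefs wk qk q0.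
Qed.

Lemma tangent_to_delta (k : 'I_m) : tangent_to k (delta_mx k 0).
Proof.
move=> p [i pk] _; rewrite tangent_delta (first_vars_mderiv (leqnn k) pk).
exact: rmorph0.
Qed.

Local Notation coord_sub k i := (pr @` first_vars k i).

Lemma coord_sub_subspace k i : lin_subspace (coord_sub k i).
Proof.
split; first by exists 0; [exact: (first_vars_subspace _ _).1 | exact: rmorph0].
move=> c _ _ [p pk <-] [q qk <-]; exists (c *: p + q).
  exact: (first_vars_subspace _ _).2.
by rewrite linearP.
Qed.

Lemma dim_le_combinations (U V : set O) l (z : 'I_l -> O) e :
  lin_subspace U -> dim_le U e ->
  (forall h, V h -> exists c : 'I_l -> O,
     (forall j, U (c j)) /\ h = \sum_j c j * z j) ->
  dim_le V (l * e).
Proof.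
move=> subU dimU Vz; have [e' ee' [w [_ wE]]] := basis_exists subU dimU.
have := @dim_le_span _ O ('I_l * 'I_e')%type
  (fun t : 'I_l * 'I_e' => w t.2 * z t.1).
rewrite card_prod !card_ord; apply: dim_leW; last by rewrite leq_mul2l ee' orbT.
move=> _ /Vz[c [Uc ->]]; apply: subspace_sum (lin_span_subspace _) _ => j _.
have := Uc j; rewrite wE; move: (c j); apply: lin_span_min.
  exact: subspace_preim (linear_fun_mulr _) (lin_span_subspace _).
by move=> _ [i _ <-]; apply: sub_lin_span; exists (j, i).
Qed.

Lemma coord_subS k i h : coord_sub k.+1 i h -> exists c : 'I_i.+1 -> O,
  (forall j, coord_sub k i (c j)) /\ h = \sum_j c j * pr (nvar k) ^+ j.
Proof.
move=> [_ [q [qk sq ->]] <-]; exists (fun j => pr q`_j); split=> [j|].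
  by exists q`_j => //; exact: qk.
rewrite pr_horner (horner_coef_wide _ (leq_trans (size_poly _ _) sq)).
by apply: eq_bigr => j _; rewrite coef_map.
Qed.

Lemma coord_subS_dim k i e : dim_le (coord_sub k i) e ->
  dim_le (coord_sub k.+1 i) (i.+1 * e).
Proof.
move=> dimk.
exact: dim_le_combinations (coord_sub_subspace k i) dimk (@coord_subS k i).
Qed.

Lemma coord_subM k i j g h : coord_sub k i g -> coord_sub k j h ->
  coord_sub k (i + j) (g * h).
Proof.
move=> [p pk <-] [q qk <-]; exists (p * q); last by rewrite rmorphM.
exact: first_varsM.
Qed.

Lemma coord_sub1 k i : coord_sub k i 1.
Proof. by exists 1; [exact: first_vars1 | exact: rmorph1]. Qed.

(** A step of pseudo-division, for coefficients that cannot be inverted. *)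
Lemma size_lead_cancel (R : comNzRingType) (f g : {poly R}) :
  f != 0 -> (0 < size g <= size f)%N ->
  (size (lead_coef g *: f -
         lead_coef f *: ('X^(size f - size g) * g))%R < size f)%N.
Proof.
rewrite -size_poly_gt0 /lead_coef.
case sf: (size f) => [//|p] _; case sg: (size g) => [//|l]; rewrite !ltnS /= => lp.
rewrite subSS; apply/leq_sizeP => j pj; rewrite coefB !coefZ coefXnM.
rewrite ltnNge (leq_trans (leq_subr _ _) pj) /=.
have [<-|jp] := eqVneq p j; first by rewrite subKn // mulrC subrr.
have {}pj : (p < j)%N by rewrite ltn_neqAle jp.
rewrite [f`_j]nth_default ?sf // mulr0 [g`_(_ - _)]nth_default ?mulr0 ?subr0 // sg.
by rewrite -(ltn_add2r (p - l)) subnK ?(leq_trans (leq_subr _ _) (ltnW pj)) // subnKC.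
Qed.

Lemma mulrn_eq0_char0 (V : lmodType K) (v : V) e : (0 < e)%N -> v *+ e = 0 ->
  v = 0.
Proof.
move=> e0; rewrite -(@scaler_nat K V) => /eqP.
by rewrite scaler_eq0 (proj1 (pcharf0P _) char0) -[_ == 0%N]negbK -lt0n e0 => /eqP.
Qed.

(** * A coordinate algebraic over the preceding ones *)

Section Algebraic.
Variables (k : 'I_m) (q0 : {poly MP}).
Hypothesis q0k : forall j, poly_in k q0`_j.
Hypothesis q0_neq0 : map_poly pr q0 != 0.
Hypothesis q0_root : pr q0.[nvar k] = 0.
Hypothesis q0_min : forall q : {poly MP}, (forall j, poly_in k q`_j) ->
  pr q.[nvar k] = 0 -> map_poly pr q != 0 ->
  (size (map_poly pr q0) <= size (map_poly pr q))%N.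
Local Notation x := (pr (nvar k)).
Local Notation g := (map_poly pr q0).
Local Notation d := (size g).-1.
Local Notation a := (lead_coef g).

Lemma alg_size : size g = d.+1.
Proof. by rewrite prednK // size_poly_gt0. Qed.

Lemma alg_degree_gt0 : (0 < d)%N.
Proof.
rewrite lt0n; apply/eqP => d0; have := q0_root; rewrite pr_horner.
have /size1_polyC -> : (size g <= 1)%N by case: (size g) d0 => [|[]].
rewrite hornerC => g0; move: q0_neq0.
have /size1_polyC -> : (size g <= 1)%N by case: (size g) d0 => [|[]].
by rewrite g0 polyC0 eqxx.
Qed.

(** Separability: the derivative of [q0] has smaller degree and is nonzero in characteristic zero,
    so by minimality it is not a relation. *)
Lemma alg_deriv_neq0 : pr (deriv q0).[nvar k] <> 0.
Proof.
move=> r0; have dE : map_poly pr (deriv q0) = deriv g.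
  by apply/polyP => i; rewrite coef_map !coef_deriv coef_map /= raddfMn.
have : (size g <= size (deriv g))%N.
  rewrite -dE; apply: q0_min => //.
    move=> j; rewrite coef_deriv; elim: {2}j.+1 => [|l IH].
      by rewrite mulr0n; exact: (poly_in_subspace k).1.
    by rewrite mulrS; exact: (subspaceD (poly_in_subspace k) (q0k _) IH).
  rewrite dE; apply/eqP => /polyP/(_ d.-1).
  rewrite coef_deriv coef0 prednK ?alg_degree_gt0 // -/(lead_coef g).
  move=> /(mulrn_eq0_char0 alg_degree_gt0)/eqP.
  by rewrite lead_coef_eq0 (negPf q0_neq0).
by rewrite leqNgt lt_size_deriv.
Qed.

(* The k-th component is changed so that the relation q0 is respected. *)
Definition alg_vector (w : 'cV[O]_m) : 'cV[O]_m :=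
  pr (deriv q0).[nvar k] *: w + (- tangent w q0.[nvar k]) *: delta_mx k 0.

Lemma alg_vector_root w : tangent (alg_vector w) q0.[nvar k] = 0.
Proof.
rewrite tangent_vec tangent_delta mderiv_horner => [|i].
  rewrite nvarE mpoly.mderivX mpoly.mnm1E eqxx.
  rewrite -[X in mpoly.mnm_sub X _]mpoly.add0m mpoly.addmK scale1r.
  by rewrite mpoly.mpolyX0 mulr1 mulNr mulrC subrr.
by have [e q0i] := q0k i; exact: first_vars_mderiv (leqnn k) q0i.
Qed.

(** Pseudo-division by [q0] makes any relation smaller and changes its image under the derivation
    only by the nonzero factor a, as the derivation respects [q0]. *)
Lemma alg_tangent w : tangent_to k w -> tangent_to k.+1 (alg_vector w).
Proof.
move=> wk; set v := alg_vector w.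
have vk : tangent_to k v.
  move=> p pk p0; rewrite tangent_vec wk // mulr0 add0r tangent_delta.
  by have [i ip] := pk; rewrite (first_vars_mderiv (leqnn k) ip) rmorph0 mulr0.
move=> _ /poly_inS[q [qk ->]].
have [e] := ubnP (size (map_poly pr q)); elim: e q qk => // e IH q qk qe q_root.
have [qz|qn0] := eqVneq (map_poly pr q) 0; first exact: tangent_ker_coefs vk qk qz.
have dq : (size g <= size (map_poly pr q))%N by exact: q0_min.
set f := map_poly pr q in qe qn0 dq.
(* The coefficients are lifted to polynomials, on which [tangent] is defined; only the image of [r]
   over O(X) is known to have smaller size. *)
pose b := q`_(size f).-1; pose c := q0`_d.
pose r := c%:P * q - b%:P * 'X^(size f - size g) * q0.
have rk j : poly_in k r`_j.
  rewrite coefB coefCM -mulrA coefCM coefXnM.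
  apply: (subspaceB (poly_in_subspace k)); first exact: poly_inM (q0k _) (qk _).
  apply: poly_inM (qk _) _; case: ifP => // _; exact: (poly_in_subspace k).1.
have r_root : pr r.[nvar k] = 0.
  rewrite /r hornerD hornerN !hornerM rmorphB !rmorphM /= q_root q0_root.
  by rewrite !mulr0 subrr.
have rsize : (size (map_poly pr r) < size f)%N.
  have -> : map_poly pr r = a *: f - lead_coef f *: ('X^(size f - size g) * g).
    rewrite rmorphB !rmorphM /= !map_polyC map_polyXn /= -!mul_polyC -mulrA.
    by rewrite /lead_coef !coef_map.
  by apply: size_lead_cancel; rewrite // size_poly_gt0 q0_neq0 dq.
have : tangent v r.[nvar k] = 0 by apply: IH => //; exact: leq_trans rsize _.
rewrite /r hornerD hornerN tangentB !hornerM hornerC tangent_polyM q_root.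
rewrite mulr0 add0r tangent_polyM q0_root mulr0 add0r alg_vector_root mulr0.
rewrite subr0 => /X_irreducible[c0|//]; exfalso.
by move: q0_neq0; rewrite -lead_coef_eq0 /lead_coef coef_map /= -/c c0 eqxx.
Qed.

Definition alg_span (N : nat) : set O := [set h | exists c : 'I_d -> O,
  (forall l, coord_sub k N (c l)) /\ h = \sum_l c l * x ^+ l].

Lemma alg_span_subspace N : lin_subspace (alg_span N).
Proof.
have subk := coord_sub_subspace k N.
split.
  exists (fun=> 0); split=> [l|]; first exact: subk.1.
  by rewrite big1 // => l _; rewrite mul0r.
move=> b _ _ [c [ck ->]] [c' [ck' ->]]; exists (fun l => b *: c l + c' l).
split=> [l|]; first exact: subk.2.
rewrite scaler_sumr -big_split; apply: eq_bigr => l _ /=.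
by rewrite mulrDl scalerAl.
Qed.

Lemma alg_spanM N N' b h : coord_sub k N b -> alg_span N' h ->
  alg_span (N + N') (b * h).
Proof.
move=> bk [c [ck ->]]; exists (fun l => b * c l); split=> [l|].
  exact: coord_subM.
by rewrite mulr_sumr; apply: eq_bigr => l _; rewrite mulrA.
Qed.

Lemma alg_relation : a * x ^+ d = - \sum_(l < d) g`_l * x ^+ l.
Proof.
have := q0_root; rewrite pr_horner (horner_coef_wide (n := d.+1)).
  by rewrite big_ord_recr /= addrC => /eqP; rewrite addr_eq0 => /eqP.
by rewrite alg_size.
Qed.

(* The relation q0 lowers the exponent of x at the cost of one factor a. *)
Lemma alg_span_power e : (forall j, first_vars k e q0`_j) ->
  forall i j, (j < d + i)%N -> alg_span (e * i) (a ^+ i * x ^+ j).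
Proof.
move=> q0e; have gk j : coord_sub k e g`_j by rewrite coef_map; exists q0`_j.
elim=> [|i IH] j ji.
  rewrite addn0 in ji; exists (fun l => (l == Ordinal ji)%:R); split=> [l|].
    by case: eqP => _; [exact: coord_sub1 | exact: (coord_sub_subspace _ _).1].
  rewrite (bigD1 (Ordinal ji)) //= eqxx big1 ?addr0 // => l /negPf ->.
  by rewrite mul0r.
rewrite mulnS; have [ji'|ij] := ltnP j (d + i).
  by rewrite exprS -mulrA; apply: alg_spanM (IH _ ji'); exact: gk.
have -> : j = (d + i)%N by apply/eqP; rewrite eqn_leq ij -ltnS -addnS ji.
have -> : a ^+ i.+1 * x ^+ (d + i) =
    \sum_(l < d) (- g`_l) * (a ^+ i * x ^+ (l + i)).
  transitivity ((a ^+ i * x ^+ i) * (a * x ^+ d)).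
    by rewrite exprSr exprD [x ^+ d * _]mulrC mulrACA.
  rewrite alg_relation mulrN mulr_sumr -sumrN; apply: eq_bigr => l _.
  rewrite exprD mulNr mulrCA; congr (- (_ * _)).
  by rewrite -mulrA [x ^+ i * _]mulrC.
apply: subspace_sum (alg_span_subspace _) _ => l _; apply: alg_spanM.
  by rewrite -scaleN1r; apply: subspaceZ (coord_sub_subspace _ _) (gk _).
by apply: IH; rewrite ltn_add2r.
Qed.

(** Multiplication by a^i is injective and lowers all exponents of x below d while the coefficients
    move to the index i + e i. The number d of powers does not depend on i, so the exponent t
    stays. *)
Lemma alg_growth C t : (forall i, dim_le (coord_sub k i) (C * i.+1 ^ t)) ->
  exists C', forall i, dim_le (coord_sub k.+1 i) (C' * i.+1 ^ t).
Proof.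
move=> growk; have [e q0e] := poly_in_coefs q0k.
exists (d * (C * e.+2 ^ t))%N => i.
have dimV : dim_le (alg_span (i + e * i)) (d * (C * e.+2 ^ t * i.+1 ^ t)).
  apply: dim_le_combinations (coord_sub_subspace k (i + e * i)) _ _; last first.
    by move=> h; apply.
  apply: (dim_leW _ _ (@growk (i + e * i)%N)) => //; rewrite -mulnA leq_mul2l -expnMn.
  apply/orP; right; have [->|t0] := posnP t; first by rewrite !expn0.
  by rewrite leq_exp2r // !mulSn mulnS addSn ltnS leq_add2l addnA leq_addl.
rewrite -[X in dim_le _ X]mul1n -card_unit -mulnA.
apply: (dim_le_joint (T := fun (_ : unit) h => a ^+ i * h) _ _ _ dimV).
- exact: coord_sub_subspace.
- exact: alg_span_subspace.
- by move=> _; exact: linear_fun_mull.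
- move=> _ h /coord_subS[c [ck ->]]; rewrite mulr_sumr.
  apply: subspace_sum (alg_span_subspace _) _ => j _; rewrite mulrCA.
  apply: alg_spanM (ck j) _; apply: alg_span_power => //.
  by rewrite (leq_trans (ltn_ord j)) // -add1n leq_add2r alg_degree_gt0.
move=> h _ /(_ tt); elim: i {dimV} => [|i IH]; first by rewrite mul1r.
rewrite exprS -mulrA => /X_irreducible[a0|/IH //].
by move: q0_neq0; rewrite -lead_coef_eq0 a0 eqxx.
Qed.

End Algebraic.
(* T is a transcendence basis chosen among the first k coordinates, and the w j,
   j \in T, are derivations dual to it up to nonzero factors. *)
Definition tangent_frame (k : nat) (T : {set 'I_m}) (w : 'I_m -> 'cV[O]_m)
    : Prop :=
  forall j, j \in T -> [/\ (j < k)%N, w j j 0 <> 0,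
    forall j', j' \in T -> j' != j -> w j j' 0 = 0,
    forall l : 'I_m, (k <= l)%N -> w j l 0 = 0 & tangent_to k (w j)].

(** A coordinate transcendental over the previous ones enters T and costs a factor i + 1. An
    algebraic one leaves the exponent unchanged, and the vectors are adapted to its minimal
    relation. *)
Lemma tangent_frame_exists k : (k <= m)%N ->
  exists (T : {set 'I_m}) (w : 'I_m -> 'cV[O]_m), tangent_frame k T w /\
    exists C, forall i, dim_le (coord_sub k i) (C * i.+1 ^ #|T|).
Proof.
elim: k => [_|k IH km].
  exists finset.set0, (fun=> 0); split=> [j|]; first by rewrite finset.in_set0.
  exists 1%N => i; rewrite finset.cards0 expn0 muln1 -card_unit.
  have := @dim_le_span K O unit (fun=> 1); apply: dim_leW => // _ [_ [c ->] <-].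
  rewrite linearZ rmorph1; apply: subspaceZ (lin_span_subspace _) _.
  by apply: sub_lin_span; exists tt.
have [T [w [frm [C growk]]]] := IH (ltnW km).
pose kk := Ordinal km.
have Tk j : j \in T -> (j == kk) = false.
  by move=> /frm[jk _ _ _ _]; rewrite -val_eqE /= ltn_eqF.
have [trk|] := pselect (transcendental k).
  (* The new vector is the partial derivative by the coordinate [kk]; the old ones vanish at [kk],
     so duality persists. *)
  exists (finset.setU (finset.set1 kk) T),
    (fun j => if j == kk then delta_mx kk 0 else w j); split.
    move=> j; rewrite finset.in_setU1; case: (eqVneq j kk) => [-> _|jk /= jT].
      split=> //=.
      - by rewrite mxE !eqxx; apply/eqP; rewrite oner_eq0.
      - by move=> j' _ /negPf jk'; rewrite mxE jk'.
      - by move=> l kl; rewrite mxE -val_eqE /= gtn_eqF.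
      - exact: transcendental_tangent trk (@tangent_to_delta kk).
    have [jk' jj wj wl wt] := frm j jT; split=> //.
    - by rewrite (leq_trans jk').
    - move=> j'; rewrite finset.in_setU1 => /orP[/eqP -> _|]; last exact: wj.
      by apply: wl.
    - by move=> l kl; apply: wl; exact: ltnW.
    - exact: transcendental_tangent.
  exists C => i; rewrite finset.cardsU1; have -> : kk \in T = false.
    by apply/negP => /Tk; rewrite eqxx.
  by rewrite add1n expnS mulnCA; exact: coord_subS_dim.
move=> ntr; pose P e := `[< exists q : {poly MP},
  [/\ forall j, poly_in k q`_j, pr q.[nvar k] = 0, map_poly pr q != 0 &
      size (map_poly pr q) = e] >].
have [|e /asboolP[q [qk q_root q0 qe]] qmin] := @ex_minnP P.
  apply: contrapT => nP; apply: ntr => q qk q_root; apply/eqP.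
  apply: contrapT => /negP q0; apply: nP.
  by exists (size (map_poly pr q)); apply/asboolP; exists q.
have {}qmin (r : {poly MP}) : (forall j, poly_in kk r`_j) ->
    pr r.[nvar kk] = 0 -> map_poly pr r != 0 ->
    (size (map_poly pr q) <= size (map_poly pr r))%N.
  by move=> rk r_root r0; rewrite qe; apply: qmin; apply/asboolP; exists r.
exists T, (fun j => alg_vector kk q (w j)); split; last first.
  exact: (@alg_growth kk q qk q0 q_root C).
move=> j jT; have [jk wjj wj wl wt] := frm j jT.
have vE l : alg_vector kk q (w j) l 0 = pr (deriv q).[nvar kk] * w j l 0 +
    (- tangent (w j) q.[nvar kk]) * (l == kk)%:R.
  by rewrite !mxE eqxx andbT.
split.
- exact: leqW.
- rewrite vE (Tk _ jT) mulr0 addr0 => /X_irreducible[|//].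
  exact: (@alg_deriv_neq0 kk q qk q0 q_root qmin).
- by move=> j' jT' jj'; rewrite vE (Tk _ jT') (wj _ jT' jj') !mulr0 addr0.
- move=> l kl; rewrite vE wl ?(ltnW kl) // -val_eqE /= gtn_eqF //.
  by rewrite !mulr0 addr0.
- exact: (@alg_tangent kk q qk q0 q_root qmin).
Qed.

Lemma tangent_frame_card T w : tangent_frame m T w -> (#|T| <= n)%N.
Proof.
move=> frm; have [L [f f0]] := domain_field X_irreducible.
pose B : 'M[L]_(#|T|, m) := \matrix_(a, j) f (w (enum_val a) j 0).
have Jw j : j \in T -> @jac_matrix K X *m w j = 0.
  move=> /frm[_ _ _ _ wt]; apply/matrixP => i l; rewrite ord1 mxE [RHS]mxE.
  rewrite -[RHS](wt _ (poly_in_all _) (proj_equation i)).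
  by apply: eq_bigr => t _; rewrite mxE.
have JB : map_mx f (@jac_matrix K X) *m B^T = 0.
  apply/matrixP => i a; rewrite [RHS]mxE.
  have /matrixP/(_ i 0) := Jw _ (enum_valP a); rewrite mxE [RHS]mxE => Jwi.
  rewrite mxE -[RHS](rmorph0 f) -[in RHS]Jwi rmorph_sum; apply: eq_bigr => t _.
  by rewrite !mxE rmorphM.
(* In the columns indexed by T, [B] is diagonal with nonzero entries. *)
have Bfree : row_free B.
  rewrite -kermx_eq0; apply/rowV0P => u /sub_kermxP uB.
  apply/rowP => a; rewrite mxE; have /rowP/(_ (enum_val a)) := uB.
  have [_ wa _ _ _] := frm _ (enum_valP a).
  rewrite mxE [RHS]mxE (bigD1 a) //= big1 ?addr0 => [|b ba].
    rewrite mxE => /eqP; rewrite mulf_eq0 => /orP[/eqP //|/eqP/f0/wa //].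
  have [_ _ wb _ _] := frm _ (enum_valP b).
  rewrite mxE wb ?enum_valP ?rmorph0 ?mulr0 //.
  by rewrite (inj_eq enum_val_inj) eq_sym.
have := mulmx0_rank_max JB; rewrite mxrank_tr (eqP Bfree).
by rewrite -[X in (_ <= X)%N](jacobian_rank X_smooth f) leq_add2l.
Qed.

Lemma coord_growth : exists C, forall i,
  dim_le (alg_filtration (codom (@coordfun K X)) i) (C * i.+1 ^ n).
Proof.
have [T [w [frm [C grow]]]] := tangent_frame_exists (leqnn m).
exists C => i; apply: (dim_leW _ _ (@grow i)); last first.
  by rewrite leq_mul2l leq_pexp2l ?orbT // (tangent_frame_card frm).
elim: i {grow} => [|i IH].
  apply: lin_span_min => [|_ ->]; [exact: coord_sub_subspace | exact: coord_sub1].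
apply: lin_span_min => [|_ [u [v [cu /IH cv ->]]]]; first exact: coord_sub_subspace.
rewrite -add1n; apply: coord_subM cv; move: u cu.
apply: lin_span_min => [|u [->|/codomP[j ->]]].
- exact: coord_sub_subspace.
- exact: coord_sub1.
- by exists (var j) => //; exact: first_vars_var.
Qed.

End CoordinateGrowth.

(** * Transfer to A *)

Section ModuleFiltration.
Set Implicit Arguments.
Unset Strict Implicit.
Local Open Scope classical_set_scope.
Variables (K : fieldType) (A : algType K) (M : lmodType A).

Lemma act_linear (m : M) : linear_fun (fun x : A => (x *: m : restr M)).
Proof.
move=> c x y; rewrite -[RHS]/((c%:A : A) *: (x *: m) + y *: m : M).
by rewrite scalerDl scalerA -scalerAl mul1r.
Qed.

Lemma act_linear_r (x : A) : linear_fun (fun m : restr M =>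
  (x *: (m : M) : restr M)).
Proof.
move=> c u v.
rewrite -[LHS]/(x *: (c%:A *: (u : M) + v) : M) scalerDr.
rewrite -[RHS]/(c%:A *: (x *: (u : M)) + x *: (v : M) : M).
by rewrite !scalerA -scalerAl mul1r -scalerAr mulr1.
Qed.

Lemma mod_filt_subspace (a : seq A) (M0 : set (restr M)) i :
  lin_subspace (mod_filtration a M0 i).
Proof. exact: lin_span_subspace. Qed.

Lemma mod_filt_act (a : seq A) (M0 : set (restr M)) i x (m : restr M) :
  alg_filtration a i x -> M0 m -> mod_filtration a M0 i (x *: (m : M)).
Proof. by move=> ax m0; apply: sub_lin_span; exists x, m. Qed.

Lemma mod_filt_le (a : seq A) (M0 : set (restr M)) i j m : (i <= j)%N ->
  mod_filtration a M0 i m -> mod_filtration a M0 j m.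
Proof.
move=> ij; move: m; apply: lin_span_min; first exact: lin_span_subspace.
move=> _ [x [m [ax m0 ->]]]; apply: mod_filt_act => //; exact: filt_le ax.
Qed.

Lemma mod_filtM (a : seq A) (M0 : set (restr M)) i j x (m : restr M) :
  alg_filtration a i x -> mod_filtration a M0 j m ->
  mod_filtration a M0 (i + j) (x *: (m : M)).
Proof.
move=> ax; move: m; apply: lin_span_min.
  exact: subspace_preim (act_linear_r x) (lin_span_subspace _).
move=> _ [y [m [ay m0 ->]]]; rewrite /mkset scalerA.
by apply: mod_filt_act => //; exact: filtM.
Qed.

Lemma mod_filt_dim (a : seq A) (M0 : set (restr M)) e i : has_lin_dim M0 e ->
  exists d, dim_le (mod_filtration a M0 i) d.
Proof.
move=> [v [_ M0v]]; have [I [w aw]] := filt_spanned a i.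
exists #|{: I * 'I_e}|.
apply: (dim_leW _ _ (@dim_le_span _ (restr M) (I * 'I_e)%type
  (fun s => w s.1 *: (v s.2 : M)))) => //.
apply: lin_span_min; first exact: lin_span_subspace.
move=> _ [x [m [ax m0 ->]]]; move: x {ax} (aw _ ax).
apply: lin_span_min.
  exact: subspace_preim (act_linear m) (lin_span_subspace _).
move=> _ [j _ <-] /=; move: m0; rewrite M0v; move: m.
apply: lin_span_min.
  exact: subspace_preim (act_linear_r (w j)) (lin_span_subspace _).
by move=> _ [l _ <-]; apply: sub_lin_span; exists (j, l).
Qed.

Lemma mod_generates_filt (a : seq A) (M0 : set (restr M)) m :
  alg_generates a -> mod_generates M0 -> exists i, mod_filtration a M0 i m.
Proof.
move=> aT [_ M0T]; have : [set: M] m by [].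
rewrite -M0T => -[k [c [w [w0 ->]]]].
have [i hi] := alg_generates_filt c aT; exists i.
apply: (@subspace_sum K (restr M)); first exact: mod_filt_subspace.
by move=> j _; apply: mod_filt_act.
Qed.

Lemma fg_module_generates : fg_module M -> exists M0 : set (restr M), mod_generates M0.
Proof.
move=> [x xT]; pose w (i : 'I_(size x)) : restr M := x`_i.
exists (lin_span (range w)); split.
  have [e _ he] := basis_exists (lin_span_subspace _) (@dim_le_span K (restr M) _ w).
  by exists e.
apply/seteqP; split=> // m _; have : [set: M] m by []; rewrite -xT.
apply: lin_span_min; first exact: lin_span_subspace.
move=> z zx; apply: sub_lin_span; apply: sub_lin_span.
have zi : (index z x < size x)%N by rewrite index_mem.
by exists (Ordinal zi) => //; rewrite /w /= nth_index.
Qed.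

End ModuleFiltration.

(** * Growth of A and of its modules *)

Section Bounds.
Set Implicit Arguments.
Unset Strict Implicit.
Local Open Scope classical_set_scope.
Variables (K : fieldType) (O : comAlgType K) (n : nat).
Hypothesis char0 : [pchar K] =i pred0.
Hypothesis domO : forall a b : O, a * b = 0 -> a = 0 \/ b = 0.
Variables (T : finType) (Ch : T -> chart O n) (h : T -> O).
Hypothesis partition_unity : \sum_t h t * chD (Ch t) = 1.
Variables (x : seq O) (B : nat).
Hypothesis xO : alg_generates x.
Hypothesis growthO : forall i, dim_le (alg_filtration x i) (B * i.+1 ^ n).
Variables (A : algType K) (C : morita_context A (diffop O)).
Variables (L1 : finType) (q1 : L1 -> mcQ C) (p1 : L1 -> mcP C).
Hypothesis one1 : is_unit_decomp q1 p1.
Variables (L2 : finType) (p2 : L2 -> mcP C) (q2 : L2 -> mcQ C).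
Hypothesis one2 : 1 = \sum_l mPQ C (p2 l) (q2 l).

Lemma morita_generates : exists a : seq A, alg_generates a.
Proof.
have gT := diffop_generates char0 partition_unity xO.
by apply: (morita_fg one1 (w := diffop_gens Ch x) one2); exact: gT.
Qed.

Lemma chart_index_exists : inhabited T.
Proof.
apply: contrapT => nt; have /eqP := partition_unity; rewrite big1.
  by rewrite eq_sym oner_eq0.
by move=> t; case: (nt (inhabits t)).
Qed.

Variable a : seq A.
Hypothesis aT : alg_generates a.

Lemma morita_upper : exists B', forall i,
  (lin_dim (alg_filtration a i) <= B' * i.+1 ^ (2 * n))%N.
Proof.
have gT := diffop_generates char0 partition_unity xO.
have [t] := chart_index_exists.
have [B' hB'] := diffop_dim_le xO (Ch t) growthO (diffop_gens Ch x).
(* In the swapped context A is sandwiched into D(X), so the decomposition of the unit of A is the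
   relevant one. *)
have one2' : @is_unit_decomp _ _ _ (morita_swap C) _ p2 q2 by exact: one2.
have [c [N hN]] := morita_dim one2' a gT.
exists (N * (B' * c.+1 ^ (2 * n)))%N => i.
have dimA := hN i _ (hB' (c * i.+1)%N).
apply: leq_trans (lin_dim_leP (filt_subspace _ _) dimA).1 _.
rewrite -!mulnA !leq_mul2l -expnMn; apply/orP; right; apply/orP; right.
have [->|n0] := posnP (2 * n)%N; first by rewrite !expn0.
by rewrite leq_exp2r // mulSn addSn ltnS leq_addl.
Qed.

Lemma lin_dim_filt i j : (i <= j)%N ->
  dim_le (alg_filtration a i) (lin_dim (alg_filtration a j)).
Proof.
move=> ij; have [d ad] := filt_dim_le a j.
have [_] := lin_dim_leP (filt_subspace _ _) ad; apply: dim_leW => // u.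
exact: filt_le.
Qed.

Lemma morita_lower : exists c N, (0 < c)%N /\ forall i,
  (i.+1 ^ (2 * n) <= N * lin_dim (alg_filtration a (c * i.+1)))%N.
Proof.
have [t] := chart_index_exists.
have [c [N hN]] := morita_dim one1 (chart_gens (Ch t)) aT.
(* The Weyl operators have index 3 n i, which sandwiching turns into c (3 n i + 1); the outer
   successor keeps the constant positive. *)
exists (c * (3 * n).+1).+1, N; split=> // i.
rewrite mul2n -addnn expnD.
apply: (chart_gens_dim char0 domO (C := Ch t)); apply: hN.
apply: lin_dim_filt; apply: leq_trans (leq_mul (leqnSn _) (leqnn _)).
rewrite -mulnA leq_mul2l; apply/orP; right.
have -> : (n * i + n * i + n * i = 3 * n * i)%N by ring.
by rewrite [((3 * n).+1 * _)%N]mulSn [(3 * n * _.+1)%N]mulnS addSn ltnS addnA leq_addl.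
Qed.

Section Module.
Variables (M : lmodType A) (m : M) (M0 : set (restr M)).
Hypothesis m_neq0 : m != 0.
Hypothesis M0M : mod_generates M0.

Lemma lin_dim_mod_filt i j : (i <= j)%N ->
  dim_le (mod_filtration a M0 i) (lin_dim (mod_filtration a M0 j)).
Proof.
move=> ij; have [[e he] _] := M0M; have [d ad] := mod_filt_dim a j he.
have [_] := lin_dim_leP (mod_filt_subspace _ _ _) ad; apply: dim_leW => // u.
exact: mod_filt_le.
Qed.

(* The functions b such that p1 b q2 kills m for all p1 form a proper ideal, so
   it is contained in the kernel of a map to a field, where some chD (Ch t) is
   nonzero by the partition of unity. *)
Lemma nonvanishing_chart : exists (l : L2) (t : T), forall j, exists k,
  sandwich (p1 k) (mulop (chD (Ch t) ^+ j)) (q2 l) *: m != 0.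
Proof.
have [l ml] : exists l, sandwich (p2 l) 1 (q2 l) *: m != 0.
  apply: contrapT => /forallNP nl; move/eqP: m_neq0; apply.
  rewrite -[m]scale1r one2 scaler_suml big1 // => l _.
  by have /negP := nl l; rewrite negbK /sandwich mBQ1 => /eqP.
exists l; pose J := [set b : O | forall k,
  sandwich (p1 k) (mulop b) (q2 l) *: m = 0].
have Jact p b : J b -> forall v, sandwich p (v * mulop b) (q2 l) *: m = 0.
  move=> Jb v; rewrite (sandwichM one1) scaler_suml big1 // => k _.
  by rewrite -scalerA Jb scaler0.
have idJ : is_ideal J.
  split=> [k|b c Jb Jc k|b c Jc k].
  - rewrite (linear_fun0 (@mulop_linear _ O)).
    by rewrite (linear_fun0 (sandwich_linear (p1 k) (q2 l))) scale0r.
  - have := mulop_linear 1 b c; rewrite !scale1r => ->.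
    have := sandwich_linear (p1 k) (q2 l) 1 (mulop b) (mulop c).
    by rewrite !scale1r => ->; rewrite scalerDl Jb Jc addr0.
  - by rewrite mulopM; exact: Jact.
have J1 : ~ J 1.
  by move=> /(Jact (p2 l))/(_ 1); rewrite mulop1 mulr1 => /eqP; rewrite (negPf ml).
have [L [f fJ]] := proper_ideal_field idJ J1.
have [t ft] : exists t, f (chD (Ch t)) != 0.
  apply: contrapT => /forallNP nt; have /eqP := rmorph1 f.
  rewrite -partition_unity rmorph_sum big1 => [|t _].
    by rewrite eq_sym oner_eq0.
  by have /negP := nt t; rewrite negbK rmorphM => /eqP ->; rewrite mulr0.
exists t => j; apply: contrapT => /forallNP nk.
have : f (chD (Ch t) ^+ j) = 0.
  by apply: fJ => k; have /negP := nk k; rewrite negbK => /eqP.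
by move/eqP; rewrite rmorphXn expf_eq0 (negPf ft) andbF.
Qed.

Lemma module_lower : exists c N, (0 < c)%N /\ forall i,
  (i.+1 ^ n <= N * lin_dim (mod_filtration a M0 (c * i.+1)))%N.
Proof.
have [l [t tl]] := nonvanishing_chart.
(* These are the components p_k w of w = u q_l m in the D(X)-module Q tensor M. They determine w
   because 1 is the sum of the q_k p_k. *)
pose nu (u : diffop O) : L1 -> restr M := fun k => sandwich (p1 k) u (q2 l) *: m.
have nu_lin : linear_fun nu.
  move=> b u v; apply/funext => k; rewrite /nu sandwich_linear.
  exact: act_linear.
have nu_ideal u v : nu v = 0 -> nu (u * v) = 0.
  move=> nuv; apply/funext => k; rewrite /nu (sandwichM one1) scaler_suml.
  rewrite big1 // => k' _; rewrite -scalerA.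
  by have := congr1 (fun g => g k') nuv; rewrite /nu => ->; exact: scaler0.
have nuD j : nu (mulop (chD (Ch t) ^+ j)) <> 0.
  move=> /(congr1 (fun g => g _)) nu0; have [k /eqP[]] := tl j; exact: nu0.
set W := alg_filtration (chart_gens (Ch t)).
have [e me] := mod_generates_filt m aT M0M.
have /choice[f hf] k := sandwich_filt one1 (chart_gens (Ch t)) (p1 k) (q2 l) aT.
pose c := (\max_k f k)%N.
have nuW j N : (c * j.+1 + e <= N)%N -> dim_le (nu @` W j)
    (#|L1| * lin_dim (mod_filtration a M0 N)).
  move=> jN; apply: (dim_le_joint (T := fun (k : L1) (g : L1 -> restr M) => g k)
    _ _ _ (@lin_dim_mod_filt _ N jN)) => //.
  - split; first by exists 0; [exact: (filt_subspace _ _).1|exact: linear_fun0].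
    move=> b _ _ [u Wu <-] [v Wv <-]; exists (b *: u + v) => //.
    exact: (filt_subspace _ _).2.
  - exact: mod_filt_subspace.
  - move=> k _ [u Wu <-]; apply: mod_filtM me; apply: filt_le (hf k _ _ Wu).
    by rewrite leq_mul2r leq_bigmax orbT.
  - by move=> g _ g0; apply/funext => k; exact: g0.
(* [bernstein_dim] uses the indices 3 n i and 6 n i. Both dimensions are bounded by the one at the
   larger index, transported by [c], with [e] accounting for [m]. *)
exists (c * (6 * n).+1 + e).+1, #|L1|; split=> // i.
have big j : (j <= 6 * n * i)%N ->
    (c * j.+1 + e <= (c * (6 * n).+1 + e).+1 * i.+1)%N.
  move=> ji; apply: leq_trans (leq_mul (leqnSn _) (leqnn _)).
  rewrite mulnDl leq_add ?leq_pmulr // -mulnA leq_mul2l; apply/orP; right.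
  rewrite [((6 * n).+1 * _)%N]mulSn [(6 * n * _.+1)%N]mulnS addSn ltnS addnA.
  by rewrite (leq_trans ji) // leq_addl.
pose j := (n * i + n * i + n * i)%N.
have jE : (6 * n * i = j + j)%N by rewrite /j; ring.
have ji : (j <= 6 * n * i)%N by rewrite jE leq_addr.
have jji : (j + j <= 6 * n * i)%N by rewrite jE.
have := bernstein_dim char0 domO nu_lin nu_ideal nuD
  (nuW _ _ (big _ ji)) (nuW _ _ (big _ jji)).
(* Both sides are squares, which halves the exponent 2n. *)
by rewrite !mulnn leq_exp2r.
Qed.

End Module.
End Bounds.

Theorem corollary1p4 (R : realType) (K : fieldType) (char0 : [pchar K] =i pred0)
    (X : affine_scheme K) (n : nat) (n_ge1 : (1 <= n)%N)
    (X_irreducible : irreducible_variety X) (X_dim : variety_dim X n)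
    (X_smooth : smooth X n)
    (A : algType K) (A_morita : morita_equivalent A (diffop (regfun X))) :
  (n%:R%:E = GK_alg R A * (2%:R^-1)%:E)%E /\
  forall M : lmodType A, fg_module M -> (exists m : M, m != 0) ->
    (n%:R%:E <= GK_mod R M)%E.
Proof.
have [C [PQ QP]] := A_morita.
have [L1 [q1 [p1 one1]]] := unit_decomp_exists QP.
have [L2 [p2 [q2 one2]]] := unit_decomp_exists (C := morita_swap C) PQ.
have [T [Ch [h hCh]]] := atlas_exists X_irreducible X_smooth.
have xO := coord_generates X.
have [B growthO] := coord_growth char0 X_irreducible X_smooth.
have [a aT] := morita_generates char0 hCh xO one1 one2.
split=> [|M fgM [m m0]].
  (* All generating families have the same growth, whichever of them [GK_alg] selects. *)
  have gkA (b : seq A) : alg_generates b ->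
      growth R (fun i => lin_dim (alg_filtration b i)) = (2 * n)%:R%:E.
    move=> bT; apply/eqP; rewrite Order.POrderTheory.eq_le; apply/andP; split.
      have [B' hB'] := morita_upper char0 hCh xO growthO one2 b.
      exact: growth_le hB'.
    have [c [N [c0 hN]]] := morita_lower char0 X_irreducible hCh one1 bT.
    exact: growth_ge c0 hN.
  have : [set growth R (fun i => lin_dim (alg_filtration b i))
      | b in @alg_generates K A]%classic (GK_alg R A).
    (* A generating family exists, so the default value -oo is not taken. *)
    apply: xgetPex.
    by exists (growth R (fun i => lin_dim (alg_filtration a i))), a.
  by move=> [b bT <-]; rewrite gkA // -EFinM natrM mulrAC divff ?mul1r //.
have [M0 M0M] := fg_module_generates fgM.
have : [set growth R (fun i => lin_dim (@mod_filtration K A M g.1 g.2 i))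
    | g in [set g | alg_generates g.1 /\ mod_generates g.2]]%classic (GK_mod R M).
  by apply: xgetPex; eexists; exists (a, M0).
move=> [[b M1] /= [bT M1M] <-].
have [c [N [c0 hN]]] :=
  module_lower char0 X_irreducible hCh one1 one2 bT m0 M1M.
exact: growth_ge c0 hN.
Qed.
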